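(* Let $M>0$ and let $\rho_1,\sigma_1\in H^2(-1,0)$, $q_1\in C([-1,0])$, $\rho_2,\sigma_2\in H^2(0,1)$, $q_2\in C([0,1])$ be real-valued and uniformly positive (each bounded below by a positive constant). Let $(\lambda_n)_{n\ge1}$ be the increasing sequence of eigenvalues of $$\begin{cases}-(\sigma_1(x)u')'+q_1(x)u=\lambda\rho_1(x)u,& x\in(-1,0),\\ -(\sigma_2(x)v')'+q_2(x)v=\lambda\rho_2(x)v,& x\in(0,1),\\ u(-1)=v(1)=0,\quad u(0)=v(0),\\ \sigma_1(0)u'(0)-\sigma_2(0)v'(0)=\lambda Mu(0),\end{cases}$$ and let $(\lambda_n')_{n\ge1}$ be the increasing sequence of eigenvalues of the regular problem obtained by replacing $M$ by $0$ in the last condition. Let $(\mu_n)_{n\ge1}$ be the sequence defined in the context. Then for $n\ge1$: if $\mu_n\ne\mu_{n+1}$, then $$\lambda_1<\lambda_1'<\mu_1\quad\text{and}\quad \mu_n<\lambda_{n+1}<\lambda_{n+1}'<\mu_{n+1};$$ and if $\mu_n=\mu_{n+1}$, then $\mu_n=\lambda_{n+1}=\lambda_{n+1}'$.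
   Context: Let $(\eta_j)_{j\ge1}$ be the eigenvalues of $-(\sigma_1y')'+q_1y=\lambda\rho_1y$ on $(-1,0)$, $y(-1)=y(0)=0$, and $(\eta_k')_{k\ge1}$ the eigenvalues of $-(\sigma_2y')'+q_2y=\lambda\rho_2y$ on $(0,1)$, $y(0)=y(1)=0$. The sequence $(\mu_n)_{n\ge1}$ is the non-decreasing enumeration of all the $\eta_j$ and $\eta_k'$ together, where a value that is both some $\eta_j$ and some $\eta'_k$ is listed twice (so $\mu_n=\mu_{n+1}$ for such a value). The eigenvalues $\lambda_n$ (and $\lambda'_n$) are simple and are listed in increasing order. *)

(* Defs.v *)
From mathcomp Require Import all_boot all_order all_algebra.
From mathcomp Require Import all_classical all_reals all_analysis.
Import Order.TTheory GRing.Theory Num.Theory.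
Import numFieldNormedType.Exports.

Set Implicit Arguments.
Unset Strict Implicit.
Unset Printing Implicit Defensive.

Local Open Scope classical_set_scope.
Local Open Scope ring_scope.

Definition in_L2 (R : realType) (a b : R) (f : R -> R) : Prop :=
  f \_ `]a, b[ \in Lfun lebesgue_measure 2%:E.

Definition test_function (R : realType) (a b : R) (phi : R -> R) : Prop :=
  (forall n x, derivable (derive1n n phi) x 1) /\
  (exists c d, [/\ a < c, d < b & forall x, x \notin `[c, d] -> phi x = 0]).

Definition weak_derivative (R : realType) (a b : R) (f g : R -> R) : Prop :=
  forall phi, test_function a b phi ->
    (\int[lebesgue_measure]_(x in `]a, b[) (f x * derive1 phi x))%R =
    - (\int[lebesgue_measure]_(x in `]a, b[) (g x * phi x))%R.

(* An element of H^2(a, b) is represented by its unique representative that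
   is continuous on the closed interval, so that f(a) and f(b) make sense. *)
Definition in_H2 (R : realType) (a b : R) (f : R -> R) : Prop :=
  {within `[a, b], continuous f} /\
  exists f1 f2, [/\ in_L2 a b f, in_L2 a b f1, in_L2 a b f2,
    weak_derivative a b f f1 & weak_derivative a b f1 f2].

Definition uniformly_positive (R : realType) (a b : R) (f : R -> R) : Prop :=
  exists2 c, 0 < c & forall x, x \in `[a, b] -> c <= f x.

(* df is the derivative of f relative to [a, b]: two-sided inside, one-sided
   at a and b. Values of f and df outside [a, b] are irrelevant. *)
Definition derivative_on (R : realType) (a b : R) (f df : R -> R) : Prop :=
  forall x, x \in `[a, b] ->
    (f y - f x) / (y - x) @[y --> within `[a, b] x^'] --> df x.

(* u solves -(sigma u')' + q u = lambda rho u on (a, b), with u' = du on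
   [a, b]. Since q, rho and u are continuous, sigma u' is C^1 up to the
   boundary for every solution, weak ones included, so solutions are taken
   in the classical sense. *)
Definition sl_solution (R : realType) (a b : R) (sigma q rho : R -> R)
    (lambda : R) (u du : R -> R) : Prop :=
  derivative_on a b u du /\
  exists2 w, derivative_on a b (fun x => sigma x * du x) w &
    forall x, x \in `]a, b[ -> - w x + q x * u x = lambda * rho x * u x.

Definition dirichlet_eigenvalue (R : realType) (a b : R)
    (sigma q rho : R -> R) (lambda : R) : Prop :=
  exists u du, [/\ sl_solution a b sigma q rho lambda u du,
    u a = 0, u b = 0 & exists2 x, x \in `[a, b] & u x != 0].

Definition transmission_eigenvalue (R : realType) (M : R)
    (sigma1 q1 rho1 sigma2 q2 rho2 : R -> R) (lambda : R) : Prop :=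
  exists u du v dv,
    [/\ sl_solution (-1) 0 sigma1 q1 rho1 lambda u du,
        sl_solution 0 1 sigma2 q2 rho2 lambda v dv,
        [/\ u (-1) = 0, v 1 = 0 & u 0 = v 0],
        sigma1 0 * du 0 - sigma2 0 * dv 0 = lambda * M * u 0 &
        (exists2 x, x \in `[-1, 0] & u x != 0) \/
        (exists2 x, x \in `[0, 1] & v x != 0)].

(* Sequences are indexed from 0: s n is the (n+1)-st term. *)
Definition increasing_enumeration (R : realType) (S : set R)
    (s : nat -> R) : Prop :=
  {homo s : m n / (m < n)%N >-> m < n} /\ range s = S.

(* The bijection with the disjoint union makes every common value of s and t
   appear twice in m. *)
Definition merged_enumeration (R : realType) (s t m : nat -> R) : Prop :=
  {homo m : i j / (i <= j)%N >-> i <= j} /\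
  exists2 e : nat -> nat + nat, bijective e &
    forall n, m n = match e n with inl j => s j | inr k => t k end.

(* Main.v *)
Require Import Defs.
From mathcomp Require Import all_boot all_order all_algebra.
From mathcomp Require Import all_classical all_reals all_analysis.
From mathcomp Require Import ring lra.
Import Order.TTheory GRing.Theory Num.Theory.
Import numFieldNormedType.Exports.

Set Implicit Arguments.
Unset Strict Implicit.
Unset Printing Implicit Defensive.

Local Open Scope classical_set_scope.
Local Open Scope ring_scope.

(** For each [l] shoot from the outer end of each half interval: let [u] solve
    the equation with [u = 0] and [sigma u' = 1] there, and let [(U l, P l)] be
    the values of [u] and of [sigma u'] at the inner end [0]; the right half is
    first reflected, so that the inner end is the right end in both cases. The
    zeros of [U1] and [U2] are then the Dirichlet eigenvalues of the two halves,
    and [l] is a transmission eigenvalue exactly when the determinant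

      [P1 U2 + U1 P2 - l M U1 U2]

    of the matching conditions vanishes ([transmission_eigenvalueP]).

    Two facts about such pairs are used. For two parameters [l < m], the
    Wronskian [P l U m - U l P m] is [(m - l)] times the integral of
    [rho u_l u_m], which is positive for [l] and [m] close to each other
    ([shooting_wronskian_positive]); so the curve [(P, U)] turns in one
    direction. And [U P > 0] for [l <= 0], because [(u p)'] is then a sum of
    nonnegative terms ([shooting_product_positive]).

    By the first fact [P / U] decreases strictly between consecutive zeros of
    [U], from plus infinity to minus infinity. Hence, between consecutive points
    of the merged sequence [mu],

      [P1 / U1 + P2 / U2 - l M]

    decreases from plus infinity to minus infinity and has exactly one root.
    By the second fact all zeros and all roots are positive, this function is
    positive for [l <= 0], and it has exactly one root below the first point of
    [mu]. A mass [M > 0] lowers the function at positive [l], and so moves each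
    root to the left ([transmission_root_mass]). At a zero of one of [U1], [U2]
    only, the determinant does not vanish; at a common zero it does.

    It remains to number the roots. The root below [mu 0], followed for each [n]
    by the root in the gap from [mu n] to [mu n.+1] or, if the gap is empty, by
    the common zero [mu n], is an increasing sequence whose range is an initial
    segment of the set of transmission eigenvalues; it is therefore their
    increasing enumeration ([interlacing_enumeration]).

    The pairs exist and depend continuously on [l] by Picard iteration
    ([linear_system_exists]) and by a Gronwall estimate of the energy
    ([energy_estimate]), which also shows that the solutions vanishing at the
    outer end are the multiples of [u]. *)

(** * Derivatives and continuity in terms of radii *)

Lemma derivative_onP (R : realType) (a b : R) (f df : R -> R) :
  derivative_on a b f df <->
  forall x, a <= x <= b -> forall e, 0 < e -> exists2 d : R, 0 < d &
    forall y, a <= y <= b -> y != x -> `|y - x| < d ->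
      `|(f y - f x) / (y - x) - df x| < e.
Proof.
split=> [H x xab e e0|H x].
- have := H x; rewrite in_itv/= xab => /(_ isT) /cvgrPdist_lt /(_ e e0) [d /= d0 K].
  exists d => // y yab yx yd; rewrite distrC; apply: K => //=.
  by rewrite distrC.
- rewrite in_itv/= => xab; apply/cvgrPdist_lt => e e0.
  have [d d0 K] := H x xab e e0.
  exists d => //= y yd yx yab; rewrite distrC; apply: K => //.
  by rewrite distrC.
Qed.

Lemma is_deriveP (R : realType) (f : R -> R) (x l : R) :
  is_derive x 1 f l <->
  forall e, 0 < e -> exists2 d : R, 0 < d &
    forall y, y != x -> `|y - x| < d -> `|(f y - f x) / (y - x) - l| < e.
Proof.
split=> [[dfx <-] e e0|H].
- move/cvgrPdist_lt: dfx => /(_ e e0) [d /= d0 K].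
  exists d => // y yx yd; rewrite distrC.
  have := K (y - x); rewrite /= sub0r normrN => /(_ yd).
  by rewrite subr_eq0 yx => /(_ isT); rewrite scaler1 subrK [_^-1 *: _]mulrC.
- suff K : (fun h => h^-1 *: (f (h *: 1 + x) - f x)) @ 0^' --> l.
    by split; [apply/cvg_ex; exists l | apply/cvg_lim].
  apply/cvgrPdist_lt => e e0; have [d d0 K] := H e e0.
  exists d => //= h; rewrite /ball_ /= sub0r normrN => hd h0.
  have := K (h + x); rewrite addrK hd -subr_eq0 addrK h0 => /(_ isT isT).
  by rewrite distrC [h%:A]mulr1 [_^-1 *: _]mulrC.
Qed.

Lemma within_continuousP (R : realType) (a b : R) (f : R -> R) :
  {within `[a, b], continuous f} <->
  forall x, a <= x <= b -> forall e, 0 < e -> exists2 d : R, 0 < d &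
    forall y, a <= y <= b -> `|y - x| < d -> `|f y - f x| < e.
Proof.
split=> [/subspace_continuousP H x xab e e0|H].
- have /cvgrPdist_lt/(_ e e0) [d /= d0 K] := H x xab.
  exists d => // y yab yd; rewrite distrC; apply: K => //=.
  by rewrite distrC.
- apply/subspace_continuousP => x /= xab; apply/cvgrPdist_lt => e e0.
  rewrite in_itv/= in xab; have [d d0 K] := H x xab e e0.
  by exists d => //= y yd yab; rewrite distrC; apply: K => //; rewrite distrC.
Qed.

Lemma continuous_distP (R : realType) (f : R -> R) :
  continuous f <->
  forall x e, 0 < e -> exists2 d : R, 0 < d &
    forall y, `|y - x| < d -> `|f y - f x| < e.
Proof.
split=> [H x e e0|H x].
- have /cvgrPdist_lt/(_ e e0) [d /= d0 K] := H x.
  by exists d => // y yd; rewrite distrC; apply: K => /=; rewrite distrC.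
- apply/cvgrPdist_lt => e e0; have [d d0 K] := H x e e0.
  by exists d => //= y yd; rewrite distrC; apply: K; rewrite distrC.
Qed.

Lemma derivative_on_continuous (R : realType) (a b : R) (f df : R -> R) :
  derivative_on a b f df -> {within `[a, b], continuous f}.
Proof.
move=> /derivative_onP H; apply/within_continuousP => x xab e e0.
have [d d0 K] := H x xab 1 ltr01.
have c0 : 0 < `|df x| + 1 by rewrite ltr_wpDl.
exists (Num.min d (e / (`|df x| + 1))); first by rewrite lt_min d0 divr_gt0.
move=> y yab; rewrite lt_min => /andP[yd ye].
have [->|yx] := eqVneq y x; first by rewrite subrr normr0.
have yx0 : y - x != 0 by rewrite subr_eq0.
have {}K := K y yab yx yd.
rewrite -[f y - f x](divfK yx0) normrM.
apply: le_lt_trans (_ : (`|df x| + 1) * `|y - x| < e); last first.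
  by rewrite mulrC -ltr_pdivlMr.
apply: ler_wpM2r => //.
rewrite -[X in `|X| <= _](subrK (df x)) addrC.
by apply: le_trans (ler_normD _ _) _; rewrite lerD2l ltW.
Qed.

Lemma derivative_on_interior (R : realType) (a b : R) (f df : R -> R) :
  derivative_on a b f df ->
  forall x, x \in `]a, b[ -> is_derive x 1 f (df x).
Proof.
move=> /derivative_onP H x; rewrite in_itv/= => /andP[ax xb].
apply/is_deriveP => e e0.
have [|d d0 K] := H x _ e e0; first by rewrite !ltW.
exists (Num.min d (Num.min (x - a) (b - x))); first by rewrite !lt_min d0 !subr_gt0 ax xb.
move=> y yx; rewrite !lt_min => /andP[yd /andP[ya yb]].
apply: K => //; move: ya yb; rewrite !ltr_distl => /andP[y1 _] /andP[_ y2].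
by apply/andP; split; lra.
Qed.

Lemma is_derive_derivative_on (R : realType) (a b : R) (f df : R -> R) :
  (forall x, a <= x <= b -> is_derive x 1 f (df x)) -> derivative_on a b f df.
Proof.
move=> H; apply/derivative_onP => x xab e e0.
have /is_deriveP/(_ e e0)[d d0 K] := H x xab.
by exists d => // y _; exact: K.
Qed.

Lemma is_derive_within_continuous (R : realType) (a b : R) (f df : R -> R) :
  (forall x, a <= x <= b -> is_derive x 1 f (df x)) ->
  {within `[a, b], continuous f}.
Proof.
by move=> H; apply: derivative_on_continuous; exact: is_derive_derivative_on H.
Qed.

(** * Sums and products *)

Lemma within_continuousD (R : realType) (A : set R) (f g : R -> R) :
  {within A, continuous f} -> {within A, continuous g} ->
  {within A, continuous (fun x => f x + g x)}.
Proof.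
move=> /subspace_continuousP cf /subspace_continuousP cg.
apply/subspace_continuousP => x Ax.
by apply: cvgD; [exact: cf|exact: cg].
Qed.

Lemma within_continuousB (R : realType) (A : set R) (f g : R -> R) :
  {within A, continuous f} -> {within A, continuous g} ->
  {within A, continuous (fun x => f x - g x)}.
Proof.
move=> /subspace_continuousP cf /subspace_continuousP cg.
apply/subspace_continuousP => x Ax.
by apply: cvgB; [exact: cf|exact: cg].
Qed.

Lemma within_continuousM (R : realType) (A : set R) (f g : R -> R) :
  {within A, continuous f} -> {within A, continuous g} ->
  {within A, continuous (fun x => f x * g x)}.
Proof.
move=> /subspace_continuousP cf /subspace_continuousP cg.
apply/subspace_continuousP => x Ax.
by apply: cvgM; [exact: cf|exact: cg].
Qed.

Lemma within_continuous_cst (R : realType) (A : set R) (c : R) :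
  {within A, continuous (fun _ : R => c)}.
Proof. by apply/subspace_continuousP => x Ax; exact: cvg_cst. Qed.

Lemma is_derive_sum (R : realType) (f g : R -> R) (x df dg : R) :
  is_derive x 1 f df -> is_derive x 1 g dg ->
  is_derive x 1 (fun t : R => f t + g t) (df + dg).
Proof. by move=> Hf Hg; exact: is_deriveD. Qed.

Lemma is_derive_diff (R : realType) (f g : R -> R) (x df dg : R) :
  is_derive x 1 f df -> is_derive x 1 g dg ->
  is_derive x 1 (fun t : R => f t - g t) (df - dg).
Proof. by move=> Hf Hg; exact: is_deriveB. Qed.

Lemma is_derive_prod (R : realType) (f g : R -> R) (x df dg : R) :
  is_derive x 1 f df -> is_derive x 1 g dg ->
  is_derive x 1 (fun t : R => f t * g t) (df * g x + f x * dg).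
Proof.
have -> : (fun t : R => f t * g t) = f * g by apply/funext.
move=> Hf Hg; apply: is_derive_eq.
by rewrite addrC [df * g x]mulrC.
Qed.

Lemma is_derive_const (R : realType) (c x : R) :
  is_derive x 1 (fun _ : R => c) 0.
Proof. exact: is_derive_cst. Qed.

(** * Consequences of the mean value theorem *)

Lemma within_continuous_sub (R : realType) (a b c d : R) (f : R -> R) :
  a <= c -> d <= b ->
  {within `[a, b], continuous f} -> {within `[c, d], continuous f}.
Proof.
move=> ac db /within_continuousP H; apply/within_continuousP => x /andP[cx xd] e e0.
have [|r r0 K] := H x _ e e0; first by rewrite (le_trans ac)//= (le_trans xd).
exists r => // y /andP[cy yd]; apply: K.
by rewrite (le_trans ac)//= (le_trans yd).
Qed.

Lemma nondecreasing_of_derivative (R : realType) (a b : R) (f df : R -> R) :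
  {within `[a, b], continuous f} ->
  (forall x, x \in `]a, b[ -> is_derive x 1 f (df x)) ->
  (forall x, x \in `]a, b[ -> 0 <= df x) ->
  forall x y, a <= x -> x <= y -> y <= b -> f x <= f y.
Proof.
move=> cf Hd H0 x y ax xy yb.
have sub z : z \in `]x, y[ -> z \in `]a, b[.
  by rewrite !in_itv/= => /andP[xz zy]; rewrite (le_lt_trans ax)//= (lt_le_trans zy).
move: xy; rewrite le_eqVlt => /predU1P[->//|xy].
have [z zxy E] := MVT xy (fun z zi => Hd z (sub z zi)) (within_continuous_sub ax yb cf).
by rewrite -subr_ge0 E mulr_ge0 ?H0 ?sub// subr_ge0 ltW.
Qed.

(** Otherwise [f] would be constant, and its derivative zero at [x0]. *)
Lemma increasing_of_derivative (R : realType) (a b x0 : R) (f df : R -> R) :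
  {within `[a, b], continuous f} ->
  (forall x, x \in `]a, b[ -> is_derive x 1 f (df x)) ->
  (forall x, x \in `]a, b[ -> 0 <= df x) ->
  x0 \in `]a, b[ -> 0 < df x0 -> f a < f b.
Proof.
move=> cf Hd H0 x0ab df0; have mono := nondecreasing_of_derivative cf Hd H0.
rewrite ltNge; apply/negP => fba.
have /is_deriveP/(_ _ df0)[d d0 K] := Hd _ x0ab.
move: (x0ab); rewrite in_itv/= => /andP[ax xb].
have m0 : 0 < Num.min d (b - x0) by rewrite lt_min d0 subr_gt0.
pose y := x0 + Num.min d (b - x0) / 2.
have yx : x0 < y by rewrite ltrDl divr_gt0.
have yb : y <= b.
  have : Num.min d (b - x0) <= b - x0 by rewrite ge_min lexx orbT.
  by rewrite /y; move: m0; lra.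
have E : f y = f x0.
  have h1 := mono a x0 (lexx a) (ltW ax) (ltW xb).
  have h2 := mono x0 y (ltW ax) (ltW yx) yb.
  have h3 := mono y b (le_trans (ltW ax) (ltW yx)) yb (lexx b).
  by apply/eqP; rewrite eq_le h2 andbT (le_trans h3)// (le_trans fba).
have yd : `|y - x0| < d.
  rewrite /y addrC addKr ger0_norm; last by rewrite divr_ge0 ?ltW.
  have : Num.min d (b - x0) <= d by rewrite ge_min lexx.
  by move: m0; lra.
have := K y _ yd; rewrite gt_eqF// => /(_ isT).
by rewrite E subrr mul0r sub0r normrN gtr0_norm// ltxx.
Qed.

Lemma mean_value_inequality (R : realType) (a b : R) (f df g dg : R -> R) :
  a <= b ->
  {within `[a, b], continuous f} -> {within `[a, b], continuous g} ->
  (forall x, x \in `]a, b[ -> is_derive x 1 f (df x)) ->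
  (forall x, x \in `]a, b[ -> is_derive x 1 g (dg x)) ->
  (forall x, x \in `]a, b[ -> `|df x| <= dg x) ->
  `|f b - f a| <= g b - g a.
Proof.
move=> ab cf cg Hf Hg H.
have h1 : g a - f a <= g b - f b.
  apply: (@nondecreasing_of_derivative _ a b (fun x => g x - f x)
    (fun x => dg x - df x) _ _ _ a b (lexx a) ab (lexx b)).
  - exact: within_continuousB.
  - by move=> x xab; apply: is_derive_diff; [exact: Hg|exact: Hf].
  - by move=> x xab; rewrite subr_ge0 (le_trans (ler_norm _) (H x xab)).
have h2 : g a + f a <= g b + f b.
  apply: (@nondecreasing_of_derivative _ a b (fun x => g x + f x)
    (fun x => dg x + df x) _ _ _ a b (lexx a) ab (lexx b)).
  - exact: within_continuousD.
  - by move=> x xab; apply: is_derive_sum; [exact: Hg|exact: Hf].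
  - move=> x xab; have := H x xab; rewrite ler_norml => /andP[+ _]; lra.
by rewrite ler_norml; apply/andP; split; move: h1 h2; lra.
Qed.

Lemma is_derive_exp_affine (R : realType) (k a x : R) :
  is_derive x 1 (fun t : R => expR (k * (t - a))) (k * expR (k * (x - a))).
Proof.
have h : is_derive x 1 (fun t : R => k * (t - a)) k.
  have := is_derive_prod (is_derive_const k x)
    (is_derive_diff (is_derive_id x 1) (is_derive_const a x)).
  by rewrite mul0r add0r subr0 mulr1.
have := @is_derive1_comp R expR (fun t : R => k * (t - a)) x _ _ (is_derive_expR _) h.
by rewrite mulrC.
Qed.

(** The comparison function is the solution of the corresponding equation:
    multiplying [g + D / K] by the integrating factor makes it nonincreasing. *)
Lemma gronwall (R : realType) (a b K D : R) (g dg : R -> R) :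
  0 < K -> {within `[a, b], continuous g} ->
  (forall x, x \in `]a, b[ -> is_derive x 1 g (dg x)) ->
  (forall x, x \in `]a, b[ -> dg x <= K * g x + D) ->
  forall x, a <= x <= b -> g x + D / K <= (g a + D / K) * expR (K * (x - a)).
Proof.
move=> K0 cg Hg H x /andP[ax xb].
pose E (t : R) := expR (- K * (t - a)).
have hd (t : R) : is_derive t 1 E (- K * E t) by exact: is_derive_exp_affine.
have cE : {within `[a, b], continuous E}.
  by apply: (@is_derive_within_continuous _ _ _ _ (fun t => - K * E t)).
have m : 0 - (g a + D / K) * E a <= 0 - (g x + D / K) * E x.
  apply: (@nondecreasing_of_derivative _ a b
    (fun t => 0 - (g t + D / K) * E t)
    (fun t => (K * (g t + D / K) - dg t) * E t) _ _ _ a x (lexx a) ax xb).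
  - apply: within_continuousB; first exact: within_continuous_cst.
    apply: within_continuousM cE; apply: within_continuousD => //.
    exact: within_continuous_cst.
  - move=> t tab; have := is_derive_diff (is_derive_const 0 t)
      (is_derive_prod (is_derive_sum (Hg t tab) (is_derive_const (D / K) t)) (hd t)).
    by move=> /is_derive_eq; apply; ring.
  - move=> t tab; rewrite mulr_ge0 ?expR_ge0// subr_ge0.
    by rewrite mulrDr [K * (D / K)]mulrC divfK ?gt_eqF ?H.
move: m; rewrite !sub0r lerN2 /E subrr mulr0 expR0 mulr1 mulNr expRN.
by rewrite -ler_pdivrMr ?expR_gt0// invrK.
Qed.

(** * Extension to the line and primitives *)

(** Composition with this projection onto [[a, b]] extends a function that is
    continuous on [[a, b]] to a continuous function on the line. *)
Definition clamp (R : realType) (a b x : R) : R := Num.max a (Num.min b x).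

Lemma clamp_itv (R : realType) (a b x : R) : a <= b -> a <= clamp a b x <= b.
Proof. by move=> ab; rewrite /clamp le_max lexx ge_max ab ge_min lexx. Qed.

Lemma clamp_id (R : realType) (a b x : R) : a <= x <= b -> clamp a b x = x.
Proof. by move=> /andP[ax xb]; rewrite /clamp min_r// max_r. Qed.

Lemma clamp_lipschitz (R : realType) (a b x y : R) :
  a <= b -> `|clamp a b y - clamp a b x| <= `|y - x|.
Proof.
move=> ab.
have cases z : [\/ z <= a /\ clamp a b z = a, a <= z <= b /\ clamp a b z = z
    | b <= z /\ clamp a b z = b].
  case: (leP z a) => za.
    by constructor 1; split=> //; apply/max_l; rewrite ge_min za orbT.
  case: (leP z b) => zb.
    by constructor 2; rewrite clamp_id// (ltW za).
  by constructor 3; split; [exact: ltW|rewrite /clamp min_l ?max_r// ltW].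
have n1 := ler_norm (y - x); have n2 := ler_norm (x - y).
rewrite distrC in n2; rewrite ler_norml.
by case: (cases x) => -[hx ->]; case: (cases y) => -[hy ->];
  apply/andP; split; move: hx hy; lra.
Qed.

Lemma continuous_clamp (R : realType) (a b : R) (f : R -> R) :
  a <= b -> {within `[a, b], continuous f} -> continuous (f \o clamp a b).
Proof.
move=> ab /within_continuousP H; apply/continuous_distP => x e e0.
have [d d0 K] := H _ (clamp_itv x ab) e e0; exists d => // y yd /=.
by apply: K; [exact: clamp_itv|exact: le_lt_trans (clamp_lipschitz x y ab) yd].
Qed.

Lemma within_continuous_bounded (R : realType) (a b : R) (f : R -> R) :
  a <= b -> {within `[a, b], continuous f} ->
  exists2 B : R, 0 < B & forall x, a <= x <= b -> `|f x| <= B.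
Proof.
move=> ab cf.
have cn : {within `[a, b], continuous (fun x => `|f x|)}.
  by move=> x; apply: continuous_comp; [exact: cf|exact: norm_continuous].
have [c _ H] := EVT_max ab cn.
by exists (`|f c| + 1) => [|x xab]; rewrite ?ltr_wpDl// ler_wpDr ?H ?in_itv.
Qed.

(** The integral is started at [a - 1], so that [a] itself is a point of
    two-sided differentiability. *)
Lemma exists_primitive (R : realType) (a : R) (f : R -> R) :
  continuous f ->
  exists2 F : R -> R, F a = 0 &
    forall x, a <= x -> is_derive x 1 F (f x).
Proof.
move=> cf.
pose G (x : R) := (\int[@lebesgue_measure R]_(t in `[a - 1, x]) f t)%R.
exists (fun x => G x - G a) => [|x ax]; first by rewrite subrr.
have [||||dG GE] := @continuous_FTC1_closed R f (a - 1) x (x + 1).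
- by rewrite ltrDl.
- apply: continuous_compact_integrable; first exact: segment_compact.
  exact: continuous_subspaceT.
- by rewrite (lt_le_trans _ ax)// gtrBl.
- exact: cf.
have dGx : is_derive x 1 G (f x) by rewrite -GE derive1E; exact/derivableP.
rewrite -[f x]subr0; exact: is_derive_diff dGx (is_derive_const _ _).
Qed.

(** * Existence for linear systems *)

Lemma le0_of_geometric_bound (R : realType) (x C : R) :
  (forall n, x <= C / 2 ^+ n) -> x <= 0.
Proof.
move=> H; rewrite leNgt; apply/negP => x0.
have C0 : 0 < C by have := H 0%N; rewrite expr0 divr1; exact: lt_le_trans.
have := H (Num.bound (C / x)); rewrite ler_pdivlMr ?exprn_gt0// mulrC.
rewrite -ler_pdivlMr// leNgt => /negP; apply; exact: upper_nthrootP.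
Qed.

(** The two sequences [s n - 2 K / 2 ^+ n] and [s n + 2 K / 2 ^+ n] are monotone
    and squeeze the limit, which is the supremum of the first one. *)
Lemma geometric_limit (R : realType) (s : nat -> R) (K : R) :
  (forall n, `|s n.+1 - s n| <= K / 2 ^+ n) ->
  exists l, forall n, `|l - s n| <= 2 * K / 2 ^+ n.
Proof.
move=> H.
pose r n : R := 2 * K / 2 ^+ n.
have rS n : r n = r n.+1 + K / 2 ^+ n.
  by rewrite /r exprS; field; rewrite expf_neq0// pnatr_eq0.
have r0 n : 0 <= r n.
  have K0 : 0 <= K by have := H 0%N; rewrite expr0 divr1; exact: le_trans.
  by rewrite divr_ge0 ?exprn_ge0// mulr_ge0.
pose lo n := s n - r n; pose up n := s n + r n.
have lo_mono : {homo lo : m n / (m <= n)%N >-> m <= n}.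
  apply: homo_leq => [x|y x z|n]; [exact: lexx|exact: le_trans|].
  have := H n; rewrite /lo (rS n) ler_norml => /andP[+ _]; lra.
have up_mono : {homo up : m n / (m <= n)%N >-> n <= m}.
  apply: homo_leq => [x|y x z xy yz|n]; [exact: lexx|exact: le_trans yz xy|].
  have := H n; rewrite /up (rS n) ler_norml => /andP[_]; lra.
have lo_up m n : lo m <= up n.
  apply: le_trans (lo_mono m (maxn m n) (leq_maxl _ _)) _.
  apply: le_trans (up_mono n (maxn m n) (leq_maxr _ _)).
  by rewrite /lo /up; have := r0 (maxn m n); lra.
have ub n : ubound (range lo) (up n) by move=> _ [m _ <-]; exact: lo_up.
exists (sup (range lo)) => n.
have h1 : lo n <= sup (range lo).
  by apply: ub_le_sup; [exists (up 0%N)|exists n].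
have h2 : sup (range lo) <= up n by apply: ge_sup; [exists (lo 0%N), 0%N|].
rewrite ler_norml; apply/andP; split; move: h1 h2; rewrite /lo /up /r; lra.
Qed.

(** In the norm weighted by [exp (- L (x - a))], integration from [a] has norm
    at most [1 / L], whatever the length of the interval. *)
Lemma primitive_weighted_bound (R : realType) (a b k L : R) (F f G g : R -> R) :
  0 <= k -> 0 < L -> F a = G a ->
  (forall x, a <= x <= b -> is_derive x 1 F (f x)) ->
  (forall x, a <= x <= b -> is_derive x 1 G (g x)) ->
  (forall x, a <= x <= b -> `|f x - g x| <= k * expR (L * (x - a))) ->
  forall x, a <= x <= b -> `|F x - G x| <= k / L * expR (L * (x - a)).
Proof.
move=> k0 L0 FG HF HG H x /andP[ax xb].
pose E (t : R) := expR (L * (t - a)).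
have dE (t : R) : is_derive t 1 (fun t => k / L * E t) (k * E t).
  have := is_derive_prod (is_derive_const (k / L) t) (is_derive_exp_affine L a t).
  by move=> /is_derive_eq; apply; rewrite mul0r add0r mulrA divfK// gt_eqF.
have sub t : a <= t <= x -> a <= t <= b.
  by move=> /andP[-> /= tx]; exact: le_trans xb.
have subo t : t \in `]a, x[ -> a <= t <= b.
  by rewrite in_itv/= => /andP[/ltW ? /ltW ?]; apply/sub/andP.
have cF := is_derive_within_continuous (fun t ht => HF t (sub t ht)).
have cG := is_derive_within_continuous (fun t ht => HG t (sub t ht)).
have := @mean_value_inequality _ a x (fun t => F t - G t) (fun t => f t - g t)
  (fun t => k / L * E t) (fun t => k * E t) ax (within_continuousB cF cG)
  (is_derive_within_continuous (fun t _ => dE t))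
  (fun t ht => is_derive_diff (HF t (subo t ht)) (HG t (subo t ht)))
  (fun t _ => dE t) (fun t ht => H t (subo t ht)).
rewrite FG subrr subr0 => /le_trans; apply.
by rewrite lerBlDr lerDl mulr_ge0 ?divr_ge0 ?expR_ge0// ltW.
Qed.

(** Picard iteration for [u], the second unknown being recovered from [u] by one
    integration. The weighted norm makes each step a contraction on the whole
    interval. Every iterate is made constant outside [[a, b]], so that it is
    continuous on the line and can be integrated again. *)
Lemma linear_system_exists (R : realType) (a b : R) (al be : R -> R) :
  a <= b -> continuous al -> continuous be ->
  exists u p : R -> R, [/\ u a = 0, p a = 1,
    forall x, a <= x <= b -> is_derive x 1 u (al x * p x) &
    forall x, a <= x <= b -> is_derive x 1 p (be x * u x)].
Proof.
move=> ab cal cbe.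
have [A A0 hA] := within_continuous_bounded ab (continuous_subspaceT cal).
have [B' B'0 hB'] := within_continuous_bounded ab (continuous_subspaceT cbe).
pose B := A + B'; have B0 : 0 < B by rewrite addr_gt0.
have alB x : a <= x <= b -> `|al x| <= B.
  by move=> /hA /le_trans; apply; rewrite lerDl ltW.
have beB x : a <= x <= b -> `|be x| <= B.
  by move=> /hB' /le_trans; apply; rewrite lerDr ltW.
have /choice[I HI] : forall f : R -> R, exists F : R -> R, continuous f ->
    F a = 0 /\ forall x, a <= x -> is_derive x 1 F (f x).
  move=> f; have [cf|ncf] := pselect (continuous f); last by exists f.
  by have [F F1 F2] := exists_primitive a cf; exists F.
have I0 f : continuous f -> I f a = 0 by move=> /HI[].
have dI f : continuous f -> forall x, a <= x <= b -> is_derive x 1 (I f) (f x).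
  by move=> /HI[_ h] x /andP[+ _]; exact: h.
have cI f : continuous f -> continuous (I f \o clamp a b).
  by move=> cf; apply: continuous_clamp => //; exact: is_derive_within_continuous (dI f cf).
(* [P f] is the second unknown belonging to the first unknown [f]. *)
pose P f x := 1 + I (fun t => be t * f t) (clamp a b x).
pose V f x := I (fun t => al t * P f t) (clamp a b x).
have cbf f : continuous f -> continuous (fun t => be t * f t).
  by move=> cf x; apply: cvgM; [exact: cbe|exact: cf].
have cP f : continuous f -> continuous (fun t => al t * P f t).
  move=> cf x; apply: cvgM; [exact: cal|apply: cvgD; first exact: cvg_cst].
  exact: cI (cbf f cf) x.
have cV f : continuous f -> continuous (V f) by move=> cf; exact: cI (cP f cf).
(* With this weight each of the two integrations in [V] gains a factor
   [B / L = 1 / 2]. *)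
pose L := 2 * B; have L0 : 0 < L by rewrite mulr_gt0.
have contraction f g k : 0 <= k -> continuous f -> continuous g ->
    (forall x, a <= x <= b -> `|f x - g x| <= k * expR (L * (x - a))) ->
    forall x, a <= x <= b -> `|V f x - V g x| <= k / 4 * expR (L * (x - a)).
  move=> k0 cf cg H x xab; rewrite /V clamp_id//.
  have -> : k / 4 = k / 2 * B / L by rewrite /L; field; rewrite gt_eqF.
  apply: (primitive_weighted_bound _ _ _ (dI _ (cP f cf)) (dI _ (cP g cg))) => //.
  - by rewrite mulr_ge0 ?divr_ge0// ltW.
  - by rewrite !I0//; exact: cP.
  move=> y yab; rewrite -mulrBr normrM mulrAC [_ * B]mulrC.
  apply: ler_pM => //; first exact: alB.
  rewrite /P opprD addrACA subrr add0r clamp_id//.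
  have -> : k / 2 = B * k / L by rewrite /L; field; rewrite gt_eqF.
  apply: (primitive_weighted_bound _ _ _ (dI _ (cbf f cf)) (dI _ (cbf g cg))) => //.
  - by rewrite mulr_ge0// ltW.
  - by rewrite !I0//; exact: cbf.
  move=> z zab; rewrite -mulrBr normrM -mulrA.
  by apply: ler_pM => //; [exact: beB|exact: H].
pose s n := iter n V (fun _ => 0).
have cs n : continuous (s n).
  by elim: n => [|n IH]; [exact: cst_continuous|exact: cV].
have [k k0 hk] := within_continuous_bounded ab (continuous_subspaceT (cs 1%N)).
have E1 x : a <= x <= b -> 1 <= expR (L * (x - a)).
  by move=> /andP[ax _]; rewrite -expR0 ler_expR mulr_ge0 ?subr_ge0// ltW.
have step n x : a <= x <= b ->
    `|s n.+1 x - s n x| <= k / 2 ^+ n * expR (L * (x - a)).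
  elim: n x => [x xab|n IH x xab].
    rewrite expr0 divr1 subr0 (le_trans (hk x xab))// ler_peMr ?E1//; exact: ltW.
  have kn0 : 0 <= k / 2 ^+ n by rewrite divr_ge0 ?exprn_ge0// ltW.
  apply: le_trans (contraction _ _ _ kn0 (cs n.+1) (cs n) IH x xab) _.
  rewrite ler_wpM2r ?expR_ge0// exprS invfM mulrCA [2^-1 * _]mulrC ler_wpM2l//.
  by lra.
have /choice[g hg] : forall x, exists y, a <= x <= b -> forall n,
    `|y - s n x| <= 2 * (k * expR (L * (x - a))) / 2 ^+ n.
  move=> x; have [xab|xab] := boolP (a <= x <= b); last by exists 0.
  have [n|l hl] := @geometric_limit _ (fun n => s n x) (k * expR (L * (x - a))).
    by rewrite mulrAC; exact: step.
  by exists l.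
pose f x := g (clamp a b x).
pose C := 2 * (k * expR (L * (b - a))).
have C0 : 0 < C by rewrite !mulr_gt0// expR_gt0.
have s_clamp n x : s n x = s n (clamp a b x).
  by case: n => [//|n]; rewrite /s /= /V [in RHS]clamp_id// clamp_itv.
have fs n x : `|f x - s n x| <= C / 2 ^+ n.
  rewrite s_clamp; have xab := clamp_itv x ab; apply: le_trans (hg _ xab n) _.
  rewrite ler_pM2r ?invr_gt0 ?exprn_gt0// ler_pM2l// ler_pM2l// ler_expR ler_pM2l//.
  by rewrite lerB//; case/andP: xab.
have cf : continuous f.
  apply/continuous_distP => x e e0.
  have [n hn] : exists n, C / 2 ^+ n < e / 3.
    apply/not_existsP => H; have : e / 3 <= 0.
      by apply: (@le0_of_geometric_bound _ _ C) => n; rewrite leNgt; apply/negP/H.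
    by rewrite leNgt divr_gt0.
  have /continuous_distP/(_ x (e / 3))[|d d0 K] := cs n; first by rewrite divr_gt0.
  exists d => // y /K; have := fs n x; have := fs n y; move: hn.
  rewrite !ler_norml !ltr_norml => h /andP[? ?] /andP[? ?] /andP[? ?].
  by apply/andP; split; lra.
pose p x := 1 + I (fun t => be t * f t) x.
pose u := I (fun t => al t * P f t).
have uf x : a <= x <= b -> u x = f x.
  move=> xab; apply/eqP; rewrite -subr_eq0 -normr_le0.
  apply: (@le0_of_geometric_bound _ _ (C / 4 * expR (L * (x - a)) + C)) => n.
  have h1 := fs n.+1 x.
  have Cn0 : 0 <= C / 2 ^+ n by rewrite divr_ge0 ?exprn_ge0// ltW.
  have h2 : `|V f x - V (s n) x| <= C / 2 ^+ n / 4 * expR (L * (x - a)).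
    apply: (contraction _ _ _ Cn0 cf (cs n)) xab => y yab.
    by rewrite (le_trans (fs n y))// ler_peMr ?E1.
  have -> : u x - f x = (V f x - V (s n) x) - (f x - s n.+1 x).
    by rewrite /V /u clamp_id//= /V clamp_id//; ring.
  apply: le_trans (ler_normB _ _) _; rewrite mulrDl; apply: lerD.
    by apply: le_trans h2 _; rewrite le_eqVlt; apply/orP; left; apply/eqP; ring.
  apply: le_trans h1 _; rewrite ler_pM2l// lef_pV2 ?posrE ?exprn_gt0//.
  by rewrite ler_weXn2l// ler1n.
exists u, p; split.
- by rewrite /u I0//; exact: cP.
- by rewrite /p I0 ?addr0//; exact: cbf.
- move=> x xab; apply: is_derive_eq; first exact: dI (cP f cf) x xab.
  by rewrite /P clamp_id.
- move=> x xab; rewrite uf//.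
  have := is_derive_sum (is_derive_const 1 x) (dI _ (cbf f cf) x xab).
  by rewrite add0r.
Qed.

(** * The initial value problem depending on the spectral parameter *)

(** The equation written as a first order system for [u] and the flux
    [p = sigma u'], with [al] in the role of [1 / sigma]. *)
Definition shooting_family (R : realType) (a b : R) (al q r : R -> R)
    (u p : R -> R -> R) : Prop :=
  forall l, [/\ u l a = 0, p l a = 1,
    forall x, a <= x <= b -> is_derive x 1 (u l) (al x * p l x) &
    forall x, a <= x <= b -> is_derive x 1 (p l) ((q x - l * r x) * u l x)].

Lemma shooting_family_exists (R : realType) (a b : R) (al q r : R -> R) :
  a <= b -> continuous al -> continuous q -> continuous r ->
  exists u p, shooting_family a b al q r u p.
Proof.
move=> ab cal cq cr.
have /choice[up H] : forall l, exists up : (R -> R) * (R -> R),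
    [/\ up.1 a = 0, up.2 a = 1,
      forall x, a <= x <= b -> is_derive x 1 up.1 (al x * up.2 x) &
      forall x, a <= x <= b -> is_derive x 1 up.2 ((q x - l * r x) * up.1 x)].
  move=> l.
  have cbe : continuous (fun x => q x - l * r x).
    move=> x; apply: cvgB; first exact: cq.
    by apply: cvgM; [exact: cvg_cst|exact: cr].
  by have [u [p H]] := linear_system_exists ab cal cbe; exists (u, p).
by exists (fun l => (up l).1), (fun l => (up l).2).
Qed.

(** Gronwall for the energy [d ^+ 2 + e ^+ 2]. It gives uniqueness for [w = 0],
    and Lipschitz dependence on the parameter for the difference of two
    solutions. *)
Lemma energy_estimate (R : realType) (a b B w : R) (al be ga d e : R -> R) :
  a <= b -> 0 < B ->
  (forall x, x \in `]a, b[ -> [/\ `|al x| <= B, `|be x| <= B & `|ga x| <= B]) ->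
  {within `[a, b], continuous d} -> {within `[a, b], continuous e} ->
  (forall x, x \in `]a, b[ -> is_derive x 1 d (al x * e x)) ->
  (forall x, x \in `]a, b[ -> is_derive x 1 e (be x * d x + w * ga x)) ->
  d a = 0 -> e a = 0 ->
  forall x, a <= x <= b ->
    `|d x| <= expR (3 * B * (b - a)) * `|w| /\
    `|e x| <= expR (3 * B * (b - a)) * `|w|.
Proof.
move=> ab B0 bnd cd ce Hd He d0 e0 x xab.
pose E t := d t * d t + e t * e t.
pose dE t := (al t * e t * d t + d t * (al t * e t)) +
  ((be t * d t + w * ga t) * e t + e t * (be t * d t + w * ga t)).
have K0 : 0 < 3 * B by rewrite mulr_gt0.
have HE t : t \in `]a, b[ -> is_derive t 1 E (dE t).
  move=> tab; have Ht := Hd t tab; have Kt := He t tab.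
  by apply: is_derive_sum; apply: is_derive_prod.
have cE : {within `[a, b], continuous E}.
  by apply: within_continuousD; exact: within_continuousM.
have le t : t \in `]a, b[ -> dE t <= 3 * B * E t + B * (w * w).
  move=> /bnd[h1 h2 h3].
  have young (c y z : R) : `|c| <= B -> 2 * (c * (y * z)) <= B * (y * y + z * z).
    move=> cB; have yz : 2 * `|y * z| <= y * y + z * z.
      by case: ger0P => _; have := sqr_ge0 (y - z);
        have := sqr_ge0 (y + z); rewrite !expr2; lra.
    apply: le_trans (ler_norm _) _; rewrite normrM ger0_norm// normrM mulrCA.
    by apply: ler_pM => //; rewrite mulr_ge0.
  have -> : dE t = 2 * (al t * (e t * d t)) + 2 * (be t * (d t * e t)) +
      2 * (ga t * (w * e t)) by rewrite /dE; ring.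
  have y1 := young _ (e t) (d t) h1; have y2 := young _ (d t) (e t) h2.
  have y3 := young _ w (e t) h3.
  have := mulr_ge0 (ltW B0) (sqr_ge0 (d t)); rewrite expr2 /E.
  by move: y1 y2 y3; lra.
have G := gronwall K0 cE HE le xab.
have w2 : B * (w * w) / (3 * B) = w * w / 3 by field; rewrite gt_eqF.
have w0 : 0 <= w * w by rewrite -expr2 sqr_ge0.
set C := expR (3 * B * (b - a)).
have C1 : 1 <= C by rewrite -expR0 ler_expR mulr_ge0 ?subr_ge0// ltW.
have EC : E x <= (C * `|w|) ^+ 2.
  have : E x <= w * w * C.
    move: G; rewrite {2}/E d0 e0 !mul0r !add0r w2 => G.
    have : E x <= w * w / 3 * expR (3 * B * (x - a)).
      by apply: le_trans G; rewrite lerDl divr_ge0.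
    move=> /le_trans; apply; apply: ler_pM; rewrite ?divr_ge0 ?expR_ge0//; first lra.
    by rewrite ler_expR ler_pM2l// lerB//; case/andP: xab.
  move=> /le_trans; apply; rewrite exprMn real_normK ?num_real// mulrC !expr2 -[C * C * _]mulrA.
  by rewrite ler_pM2l ?(lt_le_trans _ C1)// ler_peMl.
have C0 : 0 <= C * `|w| by rewrite mulr_ge0 ?expR_ge0.
have sq y : y * y <= E x -> `|y| <= C * `|w|.
  move=> yE; rewrite -ler_sqr ?nnegrE// real_normK ?num_real//.
  by apply: le_trans EC; rewrite expr2.
by split; apply: sq; rewrite /E ?lerDl ?lerDr -expr2 sqr_ge0.
Qed.

Section ShootingFamily.
Variables (R : realType) (a b : R) (al q r : R -> R) (u p : R -> R -> R).
Hypotheses (ab : a < b) (cal : {within `[a, b], continuous al})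
  (cq : {within `[a, b], continuous q}) (cr : {within `[a, b], continuous r}).
Hypotheses (al0 : forall x, a <= x <= b -> 0 < al x)
  (q0 : forall x, a <= x <= b -> 0 < q x)
  (r0 : forall x, a <= x <= b -> 0 < r x).
Hypothesis sf : shooting_family a b al q r u p.

Let oc x : x \in `]a, b[ -> a <= x <= b.
Proof. by rewrite in_itv/= => /andP[/ltW-> /ltW->]. Qed.

Let ua l : u l a = 0. Proof. by have [] := sf l. Qed.
Let pa l : p l a = 1. Proof. by have [] := sf l. Qed.
Let du l x : a <= x <= b -> is_derive x 1 (u l) (al x * p l x).
Proof. by have [_ _ H _] := sf l; exact: H. Qed.
Let dp l x : a <= x <= b -> is_derive x 1 (p l) ((q x - l * r x) * u l x).
Proof. by have [_ _ _ H] := sf l; exact: H. Qed.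
Let cu l : {within `[a, b], continuous (u l)}.
Proof. by apply: is_derive_within_continuous; exact: du. Qed.
Let cp l : {within `[a, b], continuous (p l)}.
Proof. by apply: is_derive_within_continuous; exact: dp. Qed.

Lemma coefficients_bounded (l0 : R) : exists2 B : R, 0 < B &
  forall x, a <= x <= b -> [/\ `|al x| <= B, `|r x| <= B, `|r x * u l0 x| <= B &
    forall l, `|l - l0| <= 1 -> `|q x - l * r x| <= B].
Proof.
have [B1 B10 h1] := within_continuous_bounded (ltW ab) cal.
have [B2 B20 h2] := within_continuous_bounded (ltW ab) cr.
have [B3 B30 h3] := within_continuous_bounded (ltW ab)
  (within_continuousM cr (@cu l0)).
have [B4 B40 h4] := within_continuous_bounded (ltW ab) cq.
have B5 : 0 <= (`|l0| + 1) * B2 by rewrite mulr_ge0 ?addr_ge0// ltW.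
exists (B1 + B2 + B3 + B4 + (`|l0| + 1) * B2).
  by rewrite ltr_wpDr// !addr_gt0.
move=> x xab; move: (h1 x xab) (h2 x xab) (h3 x xab) (h4 x xab) => k1 k2 k3 k4.
split; [lra|lra|lra|move=> l ll].
have : `|l * r x| <= (`|l0| + 1) * B2.
  rewrite normrM; apply: ler_pM => //.
  by rewrite -[l](subrK l0) addrC (le_trans (ler_normD _ _))// lerD2l.
by have := ler_normB (q x) (l * r x); lra.
Qed.

(** The differences satisfy the system for [l], perturbed by
    [- (l - l0) r u_l0]. *)
Lemma shooting_lipschitz (l0 : R) : exists2 C : R, 0 < C &
  forall l, `|l - l0| <= 1 -> forall x, a <= x <= b ->
    `|u l x - u l0 x| <= C * `|l - l0| /\ `|p l x - p l0 x| <= C * `|l - l0|.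
Proof.
have [B B0 H] := coefficients_bounded l0.
exists (expR (3 * B * (b - a))) => [|l ll x xab]; first exact: expR_gt0.
rewrite -[`|l - l0|]normrN.
apply: (@energy_estimate _ a b B (- (l - l0)) al (fun x => q x - l * r x)
  (fun x => r x * u l0 x) (fun x => u l x - u l0 x) (fun x => p l x - p l0 x)).
- exact: ltW.
- by [].
- by move=> y /oc yab; have [h1 _ h2 h3] := H y yab; split=> //; exact: h3.
- exact: within_continuousB.
- exact: within_continuousB.
- move=> y /oc yab; have := is_derive_diff (du l yab) (du l0 yab).
  by rewrite -mulrBr.
- move=> y /oc yab; have := is_derive_diff (dp l yab) (dp l0 yab).
  by move=> /is_derive_eq; apply; ring.
- by rewrite !ua subrr.
- by rewrite !pa subrr.
- exact: xab.
Qed.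

(** [p] is positive near [a] by continuity, so [u] increases from [0] there. *)
Lemma shooting_interior_positive (l : R) :
  exists2 x, x \in `]a, b[ & 0 < u l x /\ 0 < p l x.
Proof.
have /within_continuousP/(_ a) := @cp l.
rewrite lexx ltW// => /(_ isT 1 ltr01)[d d0 K].
have m0 : 0 < Num.min d (b - a) by rewrite lt_min d0 subr_gt0.
have md : Num.min d (b - a) <= d by rewrite ge_min lexx.
have mb : Num.min d (b - a) <= b - a by rewrite ge_min lexx orbT.
pose x := a + Num.min d (b - a) / 2.
have ax : a < x by rewrite ltrDl divr_gt0.
have xb : x < b by rewrite /x; move: m0 mb; lra.
have p0 y : a <= y <= x -> 0 < p l y.
  move=> /andP[ay yx]; have := K y; rewrite ay (le_trans yx (ltW xb)) => /(_ isT).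
  rewrite ger0_norm ?subr_ge0// pa => h.
  have : y - a < d by move: yx m0 md; rewrite /x; lra.
  by move=> /h; rewrite ltr_norml => /andP[+ _]; lra.
exists x; first by rewrite in_itv/= ax.
split; last by apply: p0; rewrite lexx ltW.
rewrite -(ua l).
have sub y : y \in `]a, x[ -> a <= y <= b.
  by rewrite in_itv/= => /andP[/ltW-> /= yx]; exact: ltW (lt_trans yx xb).
have pos y : y \in `]a, x[ -> 0 < al y * p l y.
  move=> yax; rewrite mulr_gt0 ?al0 ?sub// p0//.
  by move: yax; rewrite in_itv/= => /andP[/ltW-> /ltW->].
have y0 : (a + x) / 2 \in `]a, x[ by rewrite in_itv/=; apply/andP; split; lra.
apply: (@increasing_of_derivative _ a x ((a + x) / 2) _ (fun y => al y * p l y)).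
- exact: within_continuous_sub (lexx a) (ltW xb) (@cu l).
- by move=> y /sub; exact: du.
- by move=> y /pos/ltW.
- exact: y0.
- exact: pos.
Qed.

(** For [l <= 0] the derivative [al p ^+ 2 + (q - l r) u ^+ 2] of [u p] is
    nonnegative. *)
Lemma shooting_product_positive (l : R) : l <= 0 -> 0 < u l b * p l b.
Proof.
move=> l0; have [x xab [_ px]] := shooting_interior_positive l.
pose f y := (al y * p l y) * p l y + u l y * ((q y - l * r y) * u l y).
have f1 y : y \in `]a, b[ -> 0 <= u l y * ((q y - l * r y) * u l y).
  move=> /oc yab; rewrite mulrCA mulr_ge0 -?expr2 ?sqr_ge0// subr_ge0.
  by apply: le_trans (mulr_le0_ge0 l0 (ltW (r0 yab))) (ltW (q0 yab)).
have -> : 0 = u l a * p l a by rewrite ua mul0r.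
apply: (@increasing_of_derivative _ a b x (fun y => u l y * p l y) f).
- exact: within_continuousM.
- by move=> y /oc yab; exact: is_derive_prod (du l yab) (dp l yab).
- move=> y yab; rewrite addr_ge0 ?f1// -mulrA mulr_ge0 -?expr2 ?sqr_ge0//.
  by rewrite ltW ?al0 ?oc.
- exact: xab.
- by rewrite ltr_wpDr ?f1// !mulr_gt0// al0 ?oc.
Qed.

(** The Wronskian of two solutions has derivative [(m - l) r u_l u_m], which is
    close to [(m - l) r u_l0 ^+ 2] uniformly in [x] when [l] and [m] are close
    to [l0]. *)
Lemma shooting_wronskian_positive (l0 : R) : exists2 d : R, 0 < d &
  forall l m, l0 - d < l -> l < m -> m < l0 + d ->
    0 < p l b * u m b - u l b * p m b.
Proof.
have [C C0 lip] := shooting_lipschitz l0.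
have [B1 B10 u0B] := within_continuous_bounded (ltW ab) (@cu l0).
have [B B0 rB] := within_continuous_bounded (ltW ab) cr.
pose f x := r x * (u l0 x * u l0 x).
have cf : {within `[a, b], continuous f}.
  by apply: within_continuousM cr _; exact: within_continuousM.
have [I Ia dI] := exists_primitive a (continuous_clamp (ltW ab) cf).
have {}dI x : a <= x <= b -> is_derive x 1 I (f x).
  by move=> xab; have := dI x (andP xab).1; rewrite /= clamp_id.
have cI := is_derive_within_continuous dI.
have [x0 x0ab [ux0 _]] := shooting_interior_positive l0.
have Ib : 0 < I b.
  rewrite -Ia; apply: (increasing_of_derivative cI _ _ x0ab).
  - by move=> x /oc; exact: dI.
  - by move=> x /oc xab; rewrite mulr_ge0 -?expr2 ?sqr_ge0// ltW ?r0.
  - by rewrite !mulr_gt0// r0 ?oc.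
(* An error of [k] in the integrand changes [I b] by at most its half; [h] is
   the distance of [u_l], [u_m] to [u_l0] that keeps the error below [k]. *)
pose k := I b / (2 * (b - a)).
have ba0 : 0 < b - a by rewrite subr_gt0.
have k0 : 0 < k by rewrite divr_gt0// mulr_gt0.
have D0 : 0 < B * (2 * B1 + 1) by rewrite mulr_gt0// ltr_wpDl// mulr_ge0// ltW.
pose h := Num.min 1 (k / (B * (2 * B1 + 1))).
have h0 : 0 < h by rewrite lt_min ltr01 divr_gt0.
have h1 : h <= 1 by rewrite ge_min lexx.
have hk : B * (h * (2 * B1 + 1)) <= k.
  by rewrite mulrCA -ler_pdivlMr// ge_min lexx orbT.
pose d := Num.min 1 (h / C).
have d0 : 0 < d by rewrite lt_min ltr01 divr_gt0.
have near l : l0 - d < l -> l < l0 + d -> forall x, a <= x <= b ->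
    `|u l x - u l0 x| <= h.
  move=> l1 l2 x xab.
  have ld : `|l - l0| < d by rewrite ltr_norml; apply/andP; split; lra.
  have [|+ _] := lip l _ x xab.
    by rewrite (le_trans (ltW ld))// ge_min lexx.
  move=> /le_trans; apply; rewrite mulrC -ler_pdivlMr// (le_trans (ltW ld))//.
  by rewrite ge_min lexx orbT.
exists d => // l m dl lm md.
have nl := near l dl (lt_trans lm md); have nm := near m (lt_trans dl lm) md.
have ml0 : 0 < m - l by rewrite subr_gt0.
pose W x := p l x * u m x - u l x * p m x.
pose dW x := (m - l) * (r x * (u l x * u m x)).
have HW x : a <= x <= b -> is_derive x 1 W (dW x).
  move=> xab; have := is_derive_diff (is_derive_prod (dp l xab) (du m xab))
    (is_derive_prod (du l xab) (dp m xab)).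
  by move=> /is_derive_eq; apply; rewrite /dW; ring.
have Wa : W a = 0 by rewrite /W !ua mulr0 mul0r subrr.
have H x : x \in `]a, b[ -> f x - k <= r x * (u l x * u m x).
  move=> /oc xab; rewrite /f lerBlDl -lerBlDr -mulrBr.
  apply: le_trans (ler_norm _) _; rewrite normrM; apply: le_trans hk.
  apply: ler_pM => //; first exact: rB.
  have -> : u l0 x * u l0 x - u l x * u m x =
    - ((u l x - u l0 x) * (u m x - u l0 x) + (u l x - u l0 x) * u l0 x
       + u l0 x * (u m x - u l0 x)) by ring.
  rewrite normrN (le_trans (ler_normD _ _))// [h * _]mulrDr mulr1.
  rewrite (le_trans (lerD (ler_normD _ _) (lexx _)))// !normrM.
  have e1 : `|u l x - u l0 x| * `|u m x - u l0 x| <= h * 1.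
    by apply: ler_pM => //; [exact: nl|exact: le_trans (nm x xab) h1].
  have e2 : `|u l x - u l0 x| * `|u l0 x| <= h * B1.
    by apply: ler_pM => //; [exact: nl|exact: u0B].
  have e3 : `|u l0 x| * `|u m x - u l0 x| <= B1 * h.
    by apply: ler_pM => //; [exact: u0B|exact: nm].
  by move: e1 e2 e3; lra.
have dlin (x : R) : is_derive x 1 (fun t : R => k * (t - a)) k.
  have := is_derive_prod (is_derive_const k x)
    (is_derive_diff (is_derive_id x 1) (is_derive_const a x)).
  by rewrite mul0r add0r subr0 mulr1.
have dJ x : a <= x <= b -> is_derive x 1
    (fun t => W t - ((m - l) * (I t - k * (t - a))))
    (dW x - (m - l) * (f x - k)).
  move=> xab; have := is_derive_diff (HW x xab) (is_derive_prod
    (is_derive_const (m - l) x) (is_derive_diff (dI x xab) (dlin x))).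
  by move=> /is_derive_eq; apply; ring.
have := @nondecreasing_of_derivative _ a b _ _ (is_derive_within_continuous dJ)
  (fun x xab => dJ x (oc xab)) _ a b (lexx a) (ltW ab) (lexx b).
rewrite Wa Ia subrr mulr0 subrr mulr0 subr0 => J.
have {}J : 0 <= W b - (m - l) * (I b - k * (b - a)).
  by apply: J => x xab; rewrite subr_ge0 ler_pM2l// H.
suff : 0 < (m - l) * (I b - k * (b - a)) by rewrite /W in J *; lra.
rewrite mulr_gt0//.
have -> : I b - k * (b - a) = I b / 2 by rewrite /k; field; rewrite gt_eqF.
by rewrite divr_gt0.
Qed.

End ShootingFamily.

(** * Characteristic pairs of Sturm-Liouville problems *)

(** The planar curve [(P, U)] turns strictly counterclockwise. The inequality is
    local in [l], since two solutions for distant parameters can have a Wronskian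
    of either sign. *)
Definition rotating_pair (R : realType) (U P : R -> R) : Prop :=
  [/\ continuous U, continuous P &
    forall l0, exists2 d : R, 0 < d & forall l m,
      l0 - d < l -> l < m -> m < l0 + d -> 0 < P l * U m - U l * P m].

(** Properties of [l |-> (u l b, p l b)] on which the interlacing rests. *)
Definition characteristic_pair (R : realType) (U P : R -> R) : Prop :=
  rotating_pair U P /\ forall l, l <= 0 -> 0 < U l * P l.

(** The pairs [(u b, sigma b * u' b)], for the solutions vanishing at [a], form
    the line spanned by [(U l, P l)], nontrivial solutions giving its nonzero
    multiples. *)
Definition boundary_pair (R : realType) (a b : R) (sigma q rho U P : R -> R)
    : Prop :=
  (forall l u du, sl_solution a b sigma q rho l u du -> u a = 0 ->
    exists c, [/\ u b = c * U l, sigma b * du b = c * P l &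
      (exists2 x, x \in `[a, b] & u x != 0) -> c != 0]) /\
  (forall l c, exists u du, [/\ sl_solution a b sigma q rho l u du, u a = 0,
    u b = c * U l, sigma b * du b = c * P l &
    c != 0 -> exists2 x, x \in `[a, b] & u x != 0]).

Lemma shooting_characteristic_pair (R : realType) (a b : R)
    (al q r : R -> R) (u p : R -> R -> R) :
  a < b -> {within `[a, b], continuous al} ->
  {within `[a, b], continuous q} -> {within `[a, b], continuous r} ->
  (forall x, a <= x <= b -> 0 < al x) -> (forall x, a <= x <= b -> 0 < q x) ->
  (forall x, a <= x <= b -> 0 < r x) -> shooting_family a b al q r u p ->
  characteristic_pair (fun l => u l b) (fun l => p l b).
Proof.
move=> ab cal cq cr al0 q0 r0 sf.
have bab : a <= b <= b by rewrite lexx ltW.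
split; last by move=> l; exact: (shooting_product_positive ab al0 q0 r0 sf).
split.
- apply/continuous_distP => l0 e e0.
  have [C C0 H] := shooting_lipschitz ab cal cq cr sf l0.
  exists (Num.min 1 (e / C)) => [|l]; first by rewrite lt_min ltr01 divr_gt0.
  rewrite lt_min => /andP[/ltW/H/(_ b bab)[h _] le].
  by apply: le_lt_trans h _; rewrite mulrC -ltr_pdivlMr.
- apply/continuous_distP => l0 e e0.
  have [C C0 H] := shooting_lipschitz ab cal cq cr sf l0.
  exists (Num.min 1 (e / C)) => [|l]; first by rewrite lt_min ltr01 divr_gt0.
  rewrite lt_min => /andP[/ltW/H/(_ b bab)[_ h] le].
  by apply: le_lt_trans h _; rewrite mulrC -ltr_pdivlMr.
- by move=> l0; exact: (shooting_wronskian_positive ab cal cq cr al0 r0 sf).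
Qed.

(** The coefficients are extended from [[a, b]] to the line by constants; on
    [[a, b]] the solutions for the extended coefficients are those sought. *)
Lemma sl_characteristic_pair_exists (R : realType) (a b : R)
    (sigma q rho : R -> R) :
  a < b -> {within `[a, b], continuous sigma} ->
  {within `[a, b], continuous q} -> {within `[a, b], continuous rho} ->
  uniformly_positive a b sigma -> uniformly_positive a b q ->
  uniformly_positive a b rho ->
  exists U P, characteristic_pair U P /\ boundary_pair a b sigma q rho U P.
Proof.
move=> ab csigma cq crho sigma_pos q_pos rho_pos.
have pos f : uniformly_positive a b f -> forall x, a <= x <= b -> 0 < f x.
  by move=> [c c0 H] x xab; apply: lt_le_trans c0 (H x _); rewrite in_itv.
have s0 := pos _ sigma_pos; have leab := ltW ab.
have oc x : x \in `]a, b[ -> a <= x <= b.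
  by rewrite in_itv/= => /andP[/ltW-> /ltW->].
pose al x := (sigma (clamp a b x))^-1.
pose Q x := q (clamp a b x); pose r x := rho (clamp a b x).
have cal : continuous al.
  move=> x; apply: cvgV; last exact: continuous_clamp leab csigma x.
  by rewrite gt_eqF// s0// clamp_itv.
have cQ : continuous Q by exact: continuous_clamp.
have cr : continuous r by exact: continuous_clamp.
have alE x : a <= x <= b -> al x = (sigma x)^-1 by move=> xab; rewrite /al clamp_id.
have QE x : a <= x <= b -> Q x = q x by move=> xab; rewrite /Q clamp_id.
have rE x : a <= x <= b -> r x = rho x by move=> xab; rewrite /r clamp_id.
have al0 x : a <= x <= b -> 0 < al x by move=> xab; rewrite alE// invr_gt0 s0.
have [u [p sf]] := shooting_family_exists leab cal cQ cr.
exists (fun l => u l b), (fun l => p l b); split.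
  apply: (@shooting_characteristic_pair _ a b al Q r).
  - exact: ab.
  - exact: continuous_subspaceT.
  - exact: continuous_subspaceT.
  - exact: continuous_subspaceT.
  - exact: al0.
  - by move=> x xab; rewrite QE// (pos _ q_pos).
  - by move=> x xab; rewrite rE// (pos _ rho_pos).
  - exact: sf.
have bab : a <= b <= b by rewrite lexx leab.
split.
- move=> l v dv [Hv [w Hw eq]] va.
  have [ua pa du dp] := sf l.
  pose c := sigma a * dv a.
  have cu := is_derive_within_continuous du.
  have cp := is_derive_within_continuous dp.
  have [B1 B10 h1] := within_continuous_bounded leab (continuous_subspaceT cal).
  have cbe : continuous (fun x => Q x - l * r x).
    move=> x; apply: cvgB; first exact: cQ.
    by apply: cvgM; [exact: cvg_cst|exact: cr].
  have [B2 B20 h2] := within_continuous_bounded leab (continuous_subspaceT cbe).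
  have B0 : 0 < B1 + B2 by rewrite addr_gt0.
  have bnd x : x \in `]a, b[ -> [/\ `|al x| <= B1 + B2,
      `|Q x - l * r x| <= B1 + B2 & `|0 : R| <= B1 + B2].
    move=> /oc xab; have := h1 x xab; have := h2 x xab; rewrite normr0.
    by split; move: B10 B20; lra.
  have d1 x : x \in `]a, b[ ->
      is_derive x 1 (fun t => v t - c * u l t) (al x * (sigma x * dv x - c * p l x)).
    move=> xab; have := is_derive_diff (derivative_on_interior Hv xab)
      (is_derive_prod (is_derive_const c x) (du x (oc x xab))).
    move=> /is_derive_eq; apply; rewrite alE ?oc//; field.
    by rewrite gt_eqF// s0// oc.
  have d2 x : x \in `]a, b[ ->
      is_derive x 1 (fun t => sigma t * dv t - c * p l t)
        ((Q x - l * r x) * (v x - c * u l x) + 0 * 0).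
    move=> xab; have := is_derive_diff (derivative_on_interior Hw xab)
      (is_derive_prod (is_derive_const c x) (dp x (oc x xab))).
    move=> /is_derive_eq; apply; have := eq x xab; rewrite QE ?oc// rE ?oc//.
    by move=> e; have -> : w x = (q x - l * rho x) * v x; [move: e; lra|ring].
  have c1 : {within `[a, b], continuous (fun t => v t - c * u l t)}.
    apply: within_continuousB; first exact: derivative_on_continuous Hv.
    by apply: within_continuousM; [exact: within_continuous_cst|exact: cu].
  have c2 : {within `[a, b], continuous (fun t => sigma t * dv t - c * p l t)}.
    apply: within_continuousB; first exact: derivative_on_continuous Hw.
    by apply: within_continuousM; [exact: within_continuous_cst|exact: cp].
  have Z x : a <= x <= b -> v x = c * u l x /\ sigma x * dv x = c * p l x.
    move=> xab; have := @energy_estimate _ a b (B1 + B2) 0 al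
      (fun x => Q x - l * r x) (fun=> 0) _ _ leab B0 bnd c1 c2 d1 d2 _ _ x xab.
    rewrite /= va ua pa mulr0 subrr mulr1 subrr normr0 mulr0 !normr_le0 !subr_eq0.
    by move=> /(_ erefl erefl)[/eqP -> /eqP ->].
  have [vb pb] := Z b bab.
  exists c; split=> // -[x]; rewrite in_itv/= => /Z[-> _].
  by apply: contra_neq => ->; rewrite mul0r.
- move=> l c; have [ua pa du dp] := sf l.
  exists (fun x => c * u l x), (fun x => c * (al x * p l x)).
  have fluxE x : a <= x <= b -> sigma x * (c * (al x * p l x)) = c * p l x.
    by move=> xab; rewrite alE//; field; rewrite gt_eqF// s0.
  split.
  + split.
      apply: is_derive_derivative_on => x xab.
      have := is_derive_prod (is_derive_const c x) (du x xab).
      by rewrite mul0r add0r.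
    exists (fun x => c * ((Q x - l * r x) * u l x)).
      have D : derivative_on a b (fun x => c * p l x)
          (fun x => c * ((Q x - l * r x) * u l x)).
        apply: is_derive_derivative_on => x xab.
        have := is_derive_prod (is_derive_const c x) (dp x xab).
        by rewrite mul0r add0r.
      apply/derivative_onP => x xab e e0.
      have /derivative_onP/(_ x xab e e0)[d d0 K] := D.
      by exists d => // y yab yx yd; rewrite !fluxE//; exact: K.
    by move=> x /oc xab; rewrite QE// rE//; ring.
  + by rewrite ua mulr0.
  + by [].
  + exact: fluxE.
  + move=> c0.
    have [x xab [ux0 _]] := shooting_interior_positive ab al0 sf l.
    exists x; last by rewrite mulf_neq0// gt_eqF.
    by have := oc x xab; rewrite in_itv.
Qed.

(** * Reflection *)

Lemma derivative_on_reflection (R : realType) (a b : R) (f df : R -> R) :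
  derivative_on a b f df ->
  derivative_on (- b) (- a) (fun x => f (- x)) (fun x => - df (- x)).
Proof.
move=> /derivative_onP H; apply/derivative_onP => x xab e e0.
have opp t : - b <= t <= - a -> a <= - t <= b.
  by move=> /andP[h1 h2]; apply/andP; split; lra.
have [d d0 K] := H _ (opp x xab) e e0; exists d => // y yab yx yd.
have := K _ (opp y yab); rewrite eqr_opp => /(_ yx).
have -> : - y - - x = - (y - x) by ring.
rewrite normrN => /(_ yd).
rewrite invrN mulrN -normrN.
by congr (`|_| < _); ring.
Qed.

Lemma sl_solution_reflection (R : realType) (a b : R) (sigma q rho : R -> R)
    (l : R) (u du : R -> R) :
  sl_solution a b sigma q rho l u du ->
  sl_solution (- b) (- a) (fun x => sigma (- x)) (fun x => q (- x))
    (fun x => rho (- x)) l (fun x => u (- x)) (fun x => - du (- x)).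
Proof.
move=> [Hu [w Hw eq]]; split; first exact: derivative_on_reflection.
exists (fun x => w (- x)).
  have /derivative_onP H := derivative_on_reflection Hw.
  apply/derivative_onP => x xab e e0; have [d d0 K] := H x xab e e0.
  exists d => // y yab yx yd; have := K y yab yx yd.
  by rewrite -normrN => /le_lt_trans; apply; rewrite le_eqVlt; apply/orP; left;
    apply/eqP; congr `|_|; ring.
move=> x; rewrite in_itv/= => /andP[h1 h2]; apply: eq; rewrite in_itv/=.
by apply/andP; split; lra.
Qed.

Lemma within_continuous_reflection (R : realType) (a b : R) (f : R -> R) :
  {within `[a, b], continuous f} ->
  {within `[- b, - a], continuous (fun x => f (- x))}.
Proof.
move=> /within_continuousP H; apply/within_continuousP => x xab e e0.
have opp t : - b <= t <= - a -> a <= - t <= b.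
  by move=> /andP[h1 h2]; apply/andP; split; lra.
have [d d0 K] := H _ (opp x xab) e e0; exists d => // y /opp yab yd.
by apply: K => //; rewrite -opprD normrN.
Qed.

Lemma uniformly_positive_reflection (R : realType) (a b : R) (f : R -> R) :
  uniformly_positive a b f ->
  uniformly_positive (- b) (- a) (fun x => f (- x)).
Proof.
move=> [c c0 H]; exists c => // x; rewrite in_itv/= => /andP[h1 h2].
by apply: H; rewrite in_itv/=; apply/andP; split; lra.
Qed.

(** The same description for solutions vanishing at the right end [b]; the
    reflection reverses the sign of the flux. *)
Definition boundary_pair_right (R : realType) (a b : R)
    (sigma q rho U P : R -> R) : Prop :=
  (forall l u du, sl_solution a b sigma q rho l u du -> u b = 0 ->
    exists c, [/\ u a = c * U l, sigma a * du a = - (c * P l) &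
      (exists2 x, x \in `[a, b] & u x != 0) -> c != 0]) /\
  (forall l c, exists u du, [/\ sl_solution a b sigma q rho l u du, u b = 0,
    u a = c * U l, sigma a * du a = - (c * P l) &
    c != 0 -> exists2 x, x \in `[a, b] & u x != 0]).

Lemma sl_characteristic_pair_right_exists (R : realType) (a b : R)
    (sigma q rho : R -> R) :
  a < b -> {within `[a, b], continuous sigma} ->
  {within `[a, b], continuous q} -> {within `[a, b], continuous rho} ->
  uniformly_positive a b sigma -> uniformly_positive a b q ->
  uniformly_positive a b rho ->
  exists U P, characteristic_pair U P /\ boundary_pair_right a b sigma q rho U P.
Proof.
move=> ab cs cq cr sp qp rp.
have ba : - b < - a by rewrite ltrN2.
have [U [P [chi [H1 H2]]]] := sl_characteristic_pair_exists ba
  (within_continuous_reflection cs) (within_continuous_reflection cq)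
  (within_continuous_reflection cr) (uniformly_positive_reflection sp)
  (uniformly_positive_reflection qp) (uniformly_positive_reflection rp).
have opp x : (- x \in `[- b, - a]) = (x \in `[a, b]).
  by rewrite !in_itv/= !lerN2 andbC.
exists U, P; split=> //; split.
- move=> l u du /sl_solution_reflection sol ub.
  have [|c [e1 e2 e3]] := H1 _ _ _ sol; first by rewrite opprK.
  exists c; split; first by rewrite -e1 opprK.
    by rewrite -e2 !opprK mulrN opprK.
  move=> [x xab ux]; apply: e3; exists (- x); first by rewrite opp.
  by rewrite opprK.
- move=> l c; have [u [du [sol ub e1 e2 e3]]] := H2 l c.
  exists (fun x => u (- x)), (fun x => - du (- x)); split => //.
  + have := sl_solution_reflection sol; rewrite !opprK.
    have E (f : R -> R) : (fun x => f (- - x)) = f.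
      by apply/funext => x; rewrite opprK.
    by rewrite !E.
  + by rewrite -e2 opprK mulrN.
  + by move=> /e3[x xab ux]; exists (- x); [rewrite -opp opprK|rewrite opprK].
Qed.

(** * Characteristic equations *)

(** Where [U] and [P] both vanish, the Wronskian with any later parameter is
    zero. *)
Lemma rotating_pair_neq0 (R : realType) (U P : R -> R) (l : R) :
  rotating_pair U P -> U l = 0 -> P l != 0.
Proof.
move=> [_ _ rot] Ul; have [d d0 H] := rot l.
have := H l (l + d / 2); rewrite Ul mul0r subr0 => W.
have : 0 < P l * U (l + d / 2) by apply: W; move: d0; lra.
by apply: contraTneq => ->; rewrite mul0r ltxx.
Qed.

Lemma dirichlet_eigenvalue_left (R : realType) (a b : R)
    (sigma q rho U P : R -> R) (l : R) :
  boundary_pair a b sigma q rho U P ->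
  dirichlet_eigenvalue a b sigma q rho l <-> U l = 0.
Proof.
move=> [H1 H2]; split=> [[u [du [sol ua ub nz]]]|Ul].
- have [c [e1 _ /(_ nz) c0]] := H1 l u du sol ua.
  by apply/eqP; rewrite -(mulrI_eq0 _ (mulfI c0)) -e1 ub.
- have [u [du [sol ua ub _ nz]]] := H2 l 1.
  by exists u, du; split; rewrite ?ub ?Ul ?mulr0//; apply: nz; exact: oner_neq0.
Qed.

Lemma dirichlet_eigenvalue_right (R : realType) (a b : R)
    (sigma q rho U P : R -> R) (l : R) :
  boundary_pair_right a b sigma q rho U P ->
  dirichlet_eigenvalue a b sigma q rho l <-> U l = 0.
Proof.
move=> [H1 H2]; split=> [[u [du [sol ua ub nz]]]|Ul].
- have [c [e1 _ /(_ nz) c0]] := H1 l u du sol ub.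
  by apply/eqP; rewrite -(mulrI_eq0 _ (mulfI c0)) -e1 ua.
- have [u [du [sol ub ua _ nz]]] := H2 l 1.
  by exists u, du; split; rewrite ?ua ?Ul ?mulr0//; apply: nz; exact: oner_neq0.
Qed.

(** Determinant of the matching conditions at the point mass for solutions on
    the two sides with boundary values [(U1, P1)] and [(U2, - P2)]. *)
Definition transmission_fun (R : realType) (U1 P1 U2 P2 : R -> R) (M l : R) : R :=
  P1 l * U2 l + U1 l * P2 l - l * M * (U1 l * U2 l).

Lemma transmission_eigenvalueP (R : realType) (M : R)
    (sigma1 q1 rho1 sigma2 q2 rho2 U1 P1 U2 P2 : R -> R) (l : R) :
  rotating_pair U1 P1 -> boundary_pair (-1) 0 sigma1 q1 rho1 U1 P1 ->
  boundary_pair_right 0 1 sigma2 q2 rho2 U2 P2 ->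
  transmission_eigenvalue M sigma1 q1 rho1 sigma2 q2 rho2 l <->
  transmission_fun U1 P1 U2 P2 M l = 0.
Proof.
rewrite /transmission_fun => rot1 [H1 H2] [K1 K2]; split.
- move=> [u [du [v [dv [solu solv [ua vb uv] flux nz]]]]].
  have [c [e1 e2 e3]] := H1 l u du solu ua.
  have [d [f1 f2 f3]] := K1 l v dv solv vb.
  have m1 : c * U1 l = d * U2 l by rewrite -e1 -f1.
  have m2 : c * P1 l + d * P2 l = l * M * (c * U1 l).
    by rewrite -e1 -flux e2 f2 opprK.
  case: nz => [/e3 c0|/f3 d0].
    apply: (mulfI c0); rewrite mulr0.
    have -> : c * (P1 l * U2 l + U1 l * P2 l - l * M * (U1 l * U2 l)) =
      U2 l * (c * P1 l + d * P2 l - l * M * (c * U1 l))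
      + P2 l * (c * U1 l - d * U2 l) by ring.
    by rewrite m2 m1 !subrr !mulr0 addr0.
  apply: (mulfI d0); rewrite mulr0.
  have -> : d * (P1 l * U2 l + U1 l * P2 l - l * M * (U1 l * U2 l)) =
    U1 l * (c * P1 l + d * P2 l - l * M * (c * U1 l))
    - (P1 l - l * M * U1 l) * (c * U1 l - d * U2 l) by ring.
  by rewrite m2 m1 !subrr !mulr0 subr0.
- move=> G.
  suff [c [d [nz m1 m2]]] : exists c d, [/\ c != 0 \/ d != 0,
      c * U1 l = d * U2 l & c * P1 l + d * P2 l = l * M * (c * U1 l)].
    have [u [du [solu ua e1 e2 e3]]] := H2 l c.
    have [v [dv [solv vb f1 f2 f3]]] := K2 l d.
    exists u, du, v, dv; split=> //.
    - by rewrite e1 f1.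
    - by rewrite e2 f2 opprK m2 e1.
    - by case: nz => [/e3|/f3]; [left|right].
  have [U20|U20] := eqVneq (U2 l) 0; last first.
    by exists (U2 l), (U1 l); split; [left|exact: mulrC|move: G; lra].
  have [U10|U10] := eqVneq (U1 l) 0; last first.
    by exists (U2 l), (U1 l); split; [right|exact: mulrC|move: G; lra].
  (* At a common zero of [U1] and [U2] only the fluxes have to be matched. *)
  exists (P2 l), (- P1 l); split; last by rewrite U10; ring.
    by right; rewrite oppr_eq0; exact: rotating_pair_neq0 rot1 U10.
  by rewrite U10 U20 !mulr0.
Qed.

(** * Monotonicity and blow-up of the ratio of a rotating pair *)

(** The supremum of the points up to which [f] stays below [f l] is [m]. *)
Lemma decreasing_of_locally_decreasing (R : realType) (f : R -> R) (l m : R) :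
  l < m ->
  (forall x, l <= x <= m -> exists2 d : R, 0 < d & forall y z,
    l <= y -> x - d < y -> y < z -> z < x + d -> z <= m -> f z < f y) ->
  f m < f l.
Proof.
move=> lm H.
pose S := [set x | l <= x <= m /\ (x = l \/ f x < f l)].
have Sl : S l by split; [rewrite lexx ltW|left].
have Sm : ubound S m by move=> x [/andP[]].
have hS : has_sup S by split; [exists l|exists m].
have ls : l <= sup S by apply: ub_le_sup => //; exists m.
have sm : sup S <= m by apply: ge_sup => //; exists l.
have [|d d0 K] := H (sup S); first by rewrite ls sm.
have [x [/andP[lx xm] fx] sx] := sup_adherent d0 hS.
have xs : x <= sup S by apply: ub_le_sup; [exists m|split; [rewrite lx|]].
have below z : x < z -> z < sup S + d -> z <= m -> f z < f l.
  move=> xz zs zm; have := K x z lx sx xz zs zm.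
  by case: fx => [->//|fx] /lt_trans; exact.
have [xm'|xm'] := eqVneq x m.
  by case: fx => [xl|]; [move: lm; rewrite -xm' xl ltxx|rewrite xm'].
apply: (below m) => //; first by rewrite lt_neqAle xm'.
rewrite ltNge; apply/negP => sdm.
have : sup S + d / 2 <= sup S.
  apply: ub_le_sup; first by exists m.
  split; first by apply/andP; split; move: d0 ls sdm; lra.
  by right; apply: below; move: d0 xs sdm; lra.
by move: d0; lra.
Qed.

Lemma same_sign_of_neq0 (R : realType) (f : R -> R) (y z : R) :
  continuous f -> y <= z -> (forall x, y <= x <= z -> f x != 0) ->
  0 < f y * f z.
Proof.
move=> cf yz H; have fy : f y != 0 by rewrite H// lexx.
have fz : f z != 0 by rewrite H// lexx andbT.
rewrite ltNge; apply/negP => neg.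
have [|c] := @IVT R f y z 0 yz (continuous_subspaceT cf).
  rewrite ge_min le_max; move: fy fz neg.
  case: (ltgtP (f y) 0) => // h1 _; case: (ltgtP (f z) 0) => // h2 _.
    by rewrite leNgt nmulr_rgt0 ?h2.
  by rewrite leNgt pmulr_rgt0 ?h2.
by rewrite in_itv/= => /H/negP + /eqP.
Qed.

(** [P y / U y - P z / U z] is the Wronskian divided by [U y * U z], which is
    positive as [U] has no zero between. *)
Lemma ratio_decreasing (R : realType) (U P : R -> R) (l m : R) :
  rotating_pair U P -> l < m -> (forall x, l <= x <= m -> U x != 0) ->
  P m / U m < P l / U l.
Proof.
move=> [cU cP rot] lm nz.
apply: (@decreasing_of_locally_decreasing _ (fun x => P x / U x)) => // x xlm.
have [d d0 H] := rot x; exists d => // y z ly xy yz zx zm.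
have ss : 0 < U y * U z.
  apply: same_sign_of_neq0 cU (ltW yz) _ => t /andP[yt tz].
  by apply: nz; rewrite (le_trans ly yt) (le_trans tz zm).
have Uy : U y != 0 by rewrite nz// ly (le_trans (ltW yz)).
have Uz : U z != 0 by rewrite nz// (le_trans ly (ltW yz)).
rewrite -subr_gt0.
have -> : P y / U y - P z / U z = (P y * U z - U y * P z) / (U y * U z).
  by field; rewrite Uy Uz.
by rewrite divr_gt0// H.
Qed.

(** Just after a zero [z] of [U], the rotation gives [U] the sign of [P z], and
    [P - K U] keeps that sign near [z] by continuity. *)
Lemma ratio_right_of_zero (R : realType) (U P : R -> R) (z K : R) :
  rotating_pair U P -> U z = 0 ->
  exists2 d : R, 0 < d & forall l, z < l -> l < z + d -> K < P l / U l.
Proof.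
move=> rp Uz; have Pz := rotating_pair_neq0 rp Uz.
case: rp => cU cP rot; have [d1 d10 H] := rot z.
have cQ : continuous (fun l => P l - K * U l).
  by move=> l; apply: cvgB; [exact: cP|apply: cvgM; [exact: cvg_cst|exact: cU]].
have Pz0 : 0 < `|P z| by rewrite normr_gt0.
have /continuous_distP/(_ z _ Pz0)[d2 d20 H2] := cQ.
exists (Num.min d1 d2) => [|l zl]; first by rewrite lt_min d10.
rewrite -ltrBlDl lt_min => /andP[ld1 ld2].
have PU : 0 < P z * U l.
  by have := H z l; rewrite Uz mul0r subr0; apply; move: d10 ld1 zl; lra.
have := H2 l; rewrite gtr0_norm ?subr_gt0// => /(_ ld2).
rewrite Uz mulr0 subr0 ltr_distl => Q.
have Ul : U l != 0 by apply: contraTneq PU => ->; rewrite mulr0 ltxx.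
rewrite -subr_gt0; have -> : P l / U l - K = (P l - K * U l) / U l by field.
have [P0|P0] := ltP 0 (P z).
  move: PU; rewrite pmulr_rgt0// => Ul0; rewrite divr_gt0//.
  by move: Q; rewrite gtr0_norm// => /andP[]; lra.
have {}P0 : P z < 0 by rewrite lt_neqAle Pz.
move: PU; rewrite nmulr_rgt0// => Ul0; rewrite nmulr_rgt0 ?invr_lt0//.
by move: Q; rewrite ltr0_norm// => /andP[_]; lra.
Qed.

Lemma rotating_pair_reflection (R : realType) (U P : R -> R) :
  rotating_pair U P -> rotating_pair (fun l => U (- l)) (fun l => - P (- l)).
Proof.
move=> [cU cP rot]; split.
- by move=> x; apply: continuous_comp; [exact: opp_continuous|exact: cU].
- move=> x; apply: cvgN; rewrite -/(continuous_at x (fun l => P (- l))).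
  by apply: continuous_comp; [exact: opp_continuous|exact: cP].
- move=> l0; have [d d0 H] := rot (- l0); exists d => // l m h1 h2 h3.
  have W : 0 < P (- m) * U (- l) - U (- m) * P (- l).
    by apply: H; move: h1 h2 h3; lra.
  by move: W; lra.
Qed.

Lemma ratio_left_of_zero (R : realType) (U P : R -> R) (z K : R) :
  rotating_pair U P -> U z = 0 ->
  exists2 d : R, 0 < d & forall l, z - d < l -> l < z -> P l / U l < K.
Proof.
move=> /rotating_pair_reflection rp Uz.
have [|d d0 H] := ratio_right_of_zero (- K) rp (_ : U (- (- z)) = 0).
  by rewrite opprK.
exists d => // l h1 h2; have : - K < - P (- - l) / U (- - l).
  by apply: H; [rewrite ltrN2|move: h1; lra].
by rewrite opprK mulNr ltrN2.
Qed.

Lemma ratio_bounded_near (R : realType) (U P : R -> R) (z : R) :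
  rotating_pair U P -> U z != 0 ->
  exists2 d : R, 0 < d & forall l, `|l - z| < d ->
    `|P l / U l - P z / U z| < 1.
Proof.
move=> [cU cP _] Uz.
have : {for z, continuous (fun l => P l / U l)}.
  by apply: cvgM; [exact: cP|apply: cvgV => //; exact: cU].
move=> /cvgrPdist_lt/(_ 1 ltr01)[d /= d0 H]; exists d => // l ld.
by rewrite distrC; apply: H; rewrite /= distrC.
Qed.

(** * Roots of the transmission function *)

Section TransmissionRoots.
Variables (R : realType) (U1 P1 U2 P2 : R -> R).
Hypotheses (chi1 : characteristic_pair U1 P1) (chi2 : characteristic_pair U2 P2).

(** Away from the zeros of [U1] and [U2] this function has the same roots as
    [transmission_fun], and for [M >= 0] it decreases between those zeros. *)
Definition transmission_ratio (M l : R) : R := P1 l / U1 l + P2 l / U2 l - l * M.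

Notation G := (transmission_fun U1 P1 U2 P2).
Notation F := transmission_ratio.

Lemma transmission_fun_ratio (M l : R) : U1 l != 0 -> U2 l != 0 ->
  G M l = F M l * (U1 l * U2 l).
Proof.
move=> U10 U20; rewrite /transmission_fun /transmission_ratio; field.
by rewrite U10 U20.
Qed.

Lemma transmission_ratio_root (M l : R) : U1 l != 0 -> U2 l != 0 ->
  G M l = 0 -> F M l = 0.
Proof.
move=> U10 U20; rewrite transmission_fun_ratio// => /eqP.
by rewrite !mulf_eq0 (negbTE U10) (negbTE U20) !orbF => /eqP.
Qed.

Lemma transmission_fun_continuous (M : R) : continuous (G M).
Proof.
case: chi1 chi2 => -[cU1 cP1 _] _ [[cU2 cP2 _] _] x.
have c1 := cU1 x; have c2 := cU2 x; have c3 := cP1 x; have c4 := cP2 x.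
by apply: cvgB; [apply: cvgD; apply: cvgM|apply: cvgM; apply: cvgM => //;
  exact: cvg_cst].
Qed.

Lemma transmission_ratio_decreasing (M l m : R) : 0 <= M -> l < m ->
  (forall x, l <= x <= m -> U1 x != 0 /\ U2 x != 0) -> F M m < F M l.
Proof.
move=> M0 lm nz.
have h1 := ratio_decreasing chi1.1 lm (fun x xlm => (nz x xlm).1).
have h2 := ratio_decreasing chi2.1 lm (fun x xlm => (nz x xlm).2).
have h3 : l * M <= m * M by rewrite ler_wpM2r// ltW.
by rewrite /transmission_ratio; lra.
Qed.

Lemma characteristic_pair_zero_gt0 (l : R) : U1 l = 0 \/ U2 l = 0 -> 0 < l.
Proof.
move=> Z; rewrite ltNge; apply/negP => l0.
have := chi1.2 _ l0; have := chi2.2 _ l0.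
by case: Z => ->; rewrite mul0r ltxx.
Qed.

Lemma transmission_ratio_nonpos_gt0 (M l : R) : 0 <= M -> l <= 0 -> 0 < F M l.
Proof.
move=> M0 l0; have UP1 := chi1.2 _ l0; have UP2 := chi2.2 _ l0.
have pos (x y : R) : 0 < x * y -> 0 < y / x.
  move=> xy; have x0 : x != 0 by apply: contraTneq xy => ->; rewrite mul0r ltxx.
  have -> : y / x = x * y / x ^+ 2 by field.
  by rewrite divr_gt0// exprn_even_gt0.
have := mulr_le0_ge0 l0 M0; have := pos _ _ UP1; have := pos _ _ UP2.
by rewrite /transmission_ratio; lra.
Qed.

Lemma transmission_root_gt0 (M l : R) : 0 <= M -> G M l = 0 -> 0 < l.
Proof.
move=> M0 Gl; rewrite ltNge; apply/negP => l0.
have nz1 : U1 l != 0.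
  by apply/eqP => Z; have := characteristic_pair_zero_gt0 (or_introl Z); rewrite ltNge l0.
have nz2 : U2 l != 0.
  by apply/eqP => Z; have := characteristic_pair_zero_gt0 (or_intror Z); rewrite ltNge l0.
have := transmission_ratio_nonpos_gt0 M0 l0.
by rewrite transmission_ratio_root// ltxx.
Qed.

(** The intermediate value theorem is applied to [transmission_fun], which is
    continuous on the whole line; the factors [U1] and [U2] that distinguish it
    from the ratio have constant sign on [[c, d]]. *)
Lemma transmission_root_between (M c d : R) : c <= d ->
  (forall x, c <= x <= d -> U1 x != 0 /\ U2 x != 0) ->
  0 < F M c -> F M d < 0 -> exists2 t, c <= t <= d & G M t = 0.
Proof.
move=> cd nz Fc Fd; apply: contrapT => H.
have cc : c <= c <= d by rewrite lexx.
have dd : c <= d <= d by rewrite lexx andbT.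
have : 0 < G M c * G M d.
  apply: same_sign_of_neq0 cd _ => [|x xcd]; first exact: transmission_fun_continuous.
  by apply/eqP => Gx; apply: H; exists x.
rewrite !transmission_fun_ratio; [|exact: (nz _ _).1|exact: (nz _ _).2
  |exact: (nz _ _).1|exact: (nz _ _).2].
have -> : F M c * (U1 c * U2 c) * (F M d * (U1 d * U2 d)) =
  F M c * F M d * (U1 c * U1 d) * (U2 c * U2 d) by ring.
have s1 : 0 < U1 c * U1 d.
  by apply: same_sign_of_neq0 cd (fun x h => (nz x h).1); case: chi1 => -[].
have s2 : 0 < U2 c * U2 d.
  by apply: same_sign_of_neq0 cd (fun x h => (nz x h).2); case: chi2 => -[].
by rewrite (pmulr_lgt0 _ s2) (pmulr_lgt0 _ s1) (pmulr_rgt0 _ Fc) ltNge ltW.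
Qed.

Lemma transmission_root_unique (M t t' : R) : 0 <= M ->
  G M t = 0 -> G M t' = 0 -> t < t' ->
  exists2 x, t <= x <= t' & U1 x = 0 \/ U2 x = 0.
Proof.
move=> M0 Gt Gt' tt'; apply: contrapT => H.
have nz x : t <= x <= t' -> U1 x != 0 /\ U2 x != 0.
  by move=> xt; split; apply/eqP => Z; apply: H; exists x => //; [left|right].
have := transmission_ratio_decreasing M0 tt' nz.
have [n1 n2] : U1 t != 0 /\ U2 t != 0 by apply: nz; rewrite lexx ltW.
have [n3 n4] : U1 t' != 0 /\ U2 t' != 0 by apply: nz; rewrite lexx ltW.
by rewrite !transmission_ratio_root// ltxx.
Qed.

(** At positive [l], where all roots lie, the mass lowers the ratio; as the
    ratio decreases, its root moves to the left. *)
Lemma transmission_root_mass (M t t' : R) : 0 < M ->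
  G M t = 0 -> G 0 t' = 0 ->
  (forall x, Num.min t t' <= x <= Num.max t t' -> U1 x != 0 /\ U2 x != 0) ->
  t < t'.
Proof.
move=> M0 Gt Gt' nz; have t0 := transmission_root_gt0 (ltW M0) Gt.
have [n1 n2] : U1 t != 0 /\ U2 t != 0.
  by apply: nz; rewrite ge_min le_max lexx.
have [n3 n4] : U1 t' != 0 /\ U2 t' != 0.
  by apply: nz; rewrite ge_min le_max lexx !orbT.
have Ft : F 0 t = t * M.
  have := transmission_ratio_root n1 n2 Gt; rewrite /transmission_ratio.
  by rewrite mulr0; lra.
have Ft' := transmission_ratio_root n3 n4 Gt'.
rewrite ltNge; apply/negP; rewrite le_eqVlt => /predU1P[E|lt].
  by move: Ft; rewrite -E Ft' => /eqP; rewrite E lt_eqF// mulr_gt0.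
have := transmission_ratio_decreasing (lexx 0) lt.
rewrite Ft Ft' => /(_ _)/lt_geF; rewrite ltW ?mulr_gt0// => K.
suff : true = false by [].
by apply: K => x xt; apply: nz; rewrite min_r ?max_l// ltW.
Qed.

Lemma transmission_root_single (M l : R) : G M l = 0 -> U1 l = 0 <-> U2 l = 0.
Proof.
rewrite /transmission_fun => Gl; split=> Z; move: Gl; rewrite Z.
  rewrite !mul0r mulr0 subr0 addr0 => /eqP.
  by rewrite mulf_eq0 (negbTE (rotating_pair_neq0 chi1.1 Z)) => /eqP.
rewrite !mulr0 subr0 add0r => /eqP.
by rewrite mulf_eq0 (negbTE (rotating_pair_neq0 chi2.1 Z)) orbF => /eqP.
Qed.

End TransmissionRoots.

Lemma transmission_ratioC (R : realType) (U1 P1 U2 P2 : R -> R) (M l : R) :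
  transmission_ratio U1 P1 U2 P2 M l = transmission_ratio U2 P2 U1 P1 M l.
Proof. by rewrite /transmission_ratio [P1 l / _ + _]addrC. Qed.

(** The term of the first pair exceeds any constant near [z], and the other
    terms are bounded below there; if [U2] vanishes at [z] as well, the second
    term is even unbounded above. *)
Lemma transmission_ratio_right_of_zero1 (R : realType) (U1 P1 U2 P2 : R -> R)
    (M z : R) :
  rotating_pair U1 P1 -> rotating_pair U2 P2 -> 0 <= M -> U1 z = 0 ->
  exists2 d : R, 0 < d & forall l, z < l -> l < z + d ->
    0 < transmission_ratio U1 P1 U2 P2 M l.
Proof.
move=> rp1 rp2 M0 Z.
have [K [d2 d20 H2]] : exists K : R, exists2 d : R, 0 < d &
    forall l, z < l -> l < z + d -> K < P2 l / U2 l.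
  have [Z2|Z2] := eqVneq (U2 z) 0.
    by exists 0; exact: ratio_right_of_zero.
  have [d d0 H] := ratio_bounded_near rp2 Z2.
  exists (P2 z / U2 z - 1), d => // l zl ld.
  have := H l; rewrite gtr0_norm ?subr_gt0// ltr_distl => /(_ _)/andP[|//].
  by move: ld; lra.
have [d1 d10 H1] := ratio_right_of_zero ((z + 1) * M - K) rp1 Z.
exists (Num.min 1 (Num.min d1 d2)) => [|l zl].
  by rewrite !lt_min ltr01 d10.
rewrite -ltrBlDl !lt_min !ltrBlDl => /and3P[l1 ld1 ld2].
have h : l * M <= (z + 1) * M by rewrite ler_wpM2r// ltW.
have := H1 l zl ld1; have := H2 l zl ld2; rewrite /transmission_ratio.
by move: h; lra.
Qed.

Lemma transmission_ratio_left_of_zero1 (R : realType) (U1 P1 U2 P2 : R -> R)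
    (M z : R) :
  rotating_pair U1 P1 -> rotating_pair U2 P2 -> 0 <= M -> U1 z = 0 ->
  exists2 d : R, 0 < d & forall l, z - d < l -> l < z ->
    transmission_ratio U1 P1 U2 P2 M l < 0.
Proof.
move=> rp1 rp2 M0 Z.
have [K [d2 d20 H2]] : exists K : R, exists2 d : R, 0 < d &
    forall l, z - d < l -> l < z -> P2 l / U2 l < K.
  have [Z2|Z2] := eqVneq (U2 z) 0.
    by exists 0; exact: ratio_left_of_zero.
  have [d d0 H] := ratio_bounded_near rp2 Z2.
  exists (P2 z / U2 z + 1), d => // l ld lz.
  have := H l; rewrite distrC gtr0_norm ?subr_gt0// ltr_distl => /(_ _)/andP[|//].
  by move: ld; lra.
have [d1 d10 H1] := ratio_left_of_zero ((z - 1) * M - K) rp1 Z.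
exists (Num.min 1 (Num.min d1 d2)) => [|l].
  by rewrite !lt_min ltr01 d10.
rewrite ltrBlDr -ltrBlDl !lt_min !ltrBlDl => /and3P[l1 ld1 ld2] lz.
have h : (z - 1) * M <= l * M by rewrite ler_wpM2r//; move: l1; lra.
have {}ld1 : z - d1 < l by rewrite ltrBlDr.
have {}ld2 : z - d2 < l by rewrite ltrBlDr.
have := H1 l ld1 lz; have := H2 l ld2 lz; rewrite /transmission_ratio.
by move: h; lra.
Qed.

Section TransmissionGaps.
Variables (R : realType) (U1 P1 U2 P2 : R -> R) (M : R).
Hypotheses (chi1 : characteristic_pair U1 P1) (chi2 : characteristic_pair U2 P2)
  (M0 : 0 <= M).

Let zero (l : R) := U1 l = 0 \/ U2 l = 0.

Lemma transmission_ratio_right_of_zero (z : R) : zero z ->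
  exists2 d : R, 0 < d & forall l, z < l -> l < z + d ->
    0 < transmission_ratio U1 P1 U2 P2 M l.
Proof.
move=> [Z|Z]; first exact: transmission_ratio_right_of_zero1 chi1.1 chi2.1 M0 Z.
have [d d0 H] := transmission_ratio_right_of_zero1 chi2.1 chi1.1 M0 Z.
by exists d => // l; rewrite transmission_ratioC; exact: H.
Qed.

Lemma transmission_ratio_left_of_zero (z : R) : zero z ->
  exists2 d : R, 0 < d & forall l, z - d < l -> l < z ->
    transmission_ratio U1 P1 U2 P2 M l < 0.
Proof.
move=> [Z|Z]; first exact: transmission_ratio_left_of_zero1 chi1.1 chi2.1 M0 Z.
have [d d0 H] := transmission_ratio_left_of_zero1 chi2.1 chi1.1 M0 Z.
by exists d => // l; rewrite transmission_ratioC; exact: H.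
Qed.

Lemma transmission_gap_root (z z' : R) : zero z -> zero z' -> z < z' ->
  (forall x, z < x -> x < z' -> ~ zero x) ->
  exists t, [/\ z < t, t < z' & transmission_fun U1 P1 U2 P2 M t = 0].
Proof.
move=> Z Z' zz' nz.
have [d d0 H] := transmission_ratio_right_of_zero Z.
have [e e0 K] := transmission_ratio_left_of_zero Z'.
have m0 : 0 < Num.min d (z' - z) by rewrite lt_min d0 subr_gt0.
have md : Num.min d (z' - z) <= d by rewrite ge_min lexx.
have mz : Num.min d (z' - z) <= z' - z by rewrite ge_min lexx orbT.
have n0 : 0 < Num.min e (z' - z) by rewrite lt_min e0 subr_gt0.
have nd : Num.min e (z' - z) <= e by rewrite ge_min lexx.
have nz' : Num.min e (z' - z) <= z' - z by rewrite ge_min lexx orbT.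
have [||||t tcd Gt] := @transmission_root_between _ _ _ _ _ chi1 chi2 M
  (z + Num.min d (z' - z) / 2) (z' - Num.min e (z' - z) / 2).
- by move: mz nz'; lra.
- move=> x /andP[h1 h2]; have x1 : z < x by move: h1 m0; lra.
  have x2 : x < z' by move: h2 n0; lra.
  by split; apply/eqP => Zx; apply: (nz x x1 x2); [left|right].
- by apply: H; move: m0 md; lra.
- by apply: K; move: n0 nd; lra.
move: tcd => /andP[h1 h2]; exists t.
by split=> //; [move: h1 m0; lra|move: h2 n0; lra].
Qed.

(** The point [0] serves as the lower end, since the ratio is positive there. *)
Lemma transmission_first_root (z : R) : zero z ->
  (forall x, x < z -> ~ zero x) ->
  exists2 t, t < z & transmission_fun U1 P1 U2 P2 M t = 0.
Proof.
move=> Z nz; have z0 := characteristic_pair_zero_gt0 chi1 chi2 Z.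
have [e e0 K] := transmission_ratio_left_of_zero Z.
have n0 : 0 < Num.min e z by rewrite lt_min e0.
have nd : Num.min e z <= e by rewrite ge_min lexx.
have nz' : Num.min e z <= z by rewrite ge_min lexx orbT.
have [||||t tcd Gt] := @transmission_root_between _ _ _ _ _ chi1 chi2 M
  0 (z - Num.min e z / 2).
- by move: z0 nz'; lra.
- move=> x /andP[h1 h2]; have x2 : x < z by move: h2 n0; lra.
  by split; apply/eqP => Zx; apply: (nz x x2); [left|right].
- exact: transmission_ratio_nonpos_gt0.
- by apply: K; move: n0 nd; lra.
by exists t => //; move: tcd => /andP[_]; move: n0; lra.
Qed.

End TransmissionGaps.

(** * Counting *)

Lemma increasing_nat_ge (f : nat -> nat) :
  {homo f : m n / (m < n)%N >-> (m < n)%N} -> forall n, (n <= f n)%N.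
Proof.
by move=> H; elim=> [//|n IH]; apply: leq_ltn_trans IH (H _ _ (ltnSn n)).
Qed.

Lemma increasing_reflects_lt (R : realType) (f : nat -> R) :
  {homo f : m n / (m < n)%N >-> m < n} -> forall m n, f m < f n -> (m < n)%N.
Proof.
move=> H m n fmn; rewrite ltnNge; apply/negP; rewrite leq_eqVlt => /predU1P[E|/H].
  by rewrite E ltxx in fmn.
by rewrite ltNge ltW.
Qed.

(** An initial segment of a set is enumerated like the set itself: both
    enumerations are reparametrizations of each other by increasing maps
    [nat -> nat], which lie above the identity. *)
Lemma enumeration_initial_segment (R : realType) (T : set R) (lam L : nat -> R) :
  increasing_enumeration T lam -> {homo L : m n / (m < n)%N >-> m < n} ->
  (forall n, T (L n)) -> (forall t n, T t -> t <= L n -> exists k, L k = t) ->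
  forall n, lam n = L n.
Proof.
move=> [lam_inc lamT] L_inc LT seg.
have lamP k : T (lam k) by rewrite -lamT; exists k.
have /choice[f fE] : forall n, exists k, lam k = L n.
  by move=> n; have := LT n; rewrite -lamT => -[k _ <-]; exists k.
have lam_le : {homo lam : m n / (m <= n)%N >-> m <= n} by exact: ltW_homo.
have L_le : {homo L : m n / (m <= n)%N >-> m <= n} by exact: ltW_homo.
have f_inc : {homo f : m n / (m < n)%N >-> (m < n)%N}.
  move=> m n mn; apply: (increasing_reflects_lt lam_inc).
  by rewrite !fE; exact: L_inc.
have lamL n : lam n <= L n.
  by rewrite -fE; apply: lam_le; exact: increasing_nat_ge.
have /choice[g gE] : forall n, exists k, L k = lam n.
  by move=> n; apply: seg (lamL n).
have g_inc : {homo g : m n / (m < n)%N >-> (m < n)%N}.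
  move=> m n mn; apply: (increasing_reflects_lt L_inc).
  by rewrite !gE; exact: lam_inc.
move=> n; apply/eqP; rewrite eq_le lamL -gE; apply: L_le.
exact: increasing_nat_ge.
Qed.

Section MergedEnumeration.
Variables (R : realType) (s t m : nat -> R).
Hypotheses (s_inc : {homo s : i j / (i < j)%N >-> i < j})
  (t_inc : {homo t : i j / (i < j)%N >-> i < j})
  (mE : merged_enumeration s t m).

Let inj (f : nat -> R) : {homo f : i j / (i < j)%N >-> i < j} -> injective f.
Proof.
move=> f_inc i j fij; have [h|h|//] := ltngtP i j;
  by have := f_inc _ _ h; rewrite fij ltxx.
Qed.

Lemma merged_range (x : R) :
  (exists n, m n = x) <-> (range s x \/ range t x).
Proof.
case: mE => _ [e [e' eK e'K] H]; split.
- by move=> [n <-]; rewrite H; case: (e n) => j; [left|right]; exists j.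
- by case=> -[j _ <-]; [exists (e' (inl j))|exists (e' (inr j))];
    rewrite H e'K.
Qed.

(** Each of [s] and [t] takes a value at most once. *)
Lemma merged_repeated (i j : nat) :
  i <> j -> m i = m j -> range s (m i) /\ range t (m i).
Proof.
case: mE => _ [e [e' eK e'K] H] ij mij.
have eij : e i <> e j by move=> h; apply: ij; rewrite -(eK i) h eK.
rewrite {2}mij !H; rewrite !H in mij.
move: eij mij; case: (e i) (e j) => [k|k] [l|l] /= eij mij.
- by case: eij; rewrite (inj s_inc mij).
- by split; [exists k|exists l].
- by split; [rewrite mij; exists l|rewrite -mij; exists k].
- by case: eij; rewrite (inj t_inc mij).
Qed.

(** The two indices of a common value need not be adjacent a priori, but by
    monotonicity [m] is constant between them. *)
Lemma merged_common (x : R) :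
  range s x -> range t x -> exists2 i, m i = x & m i.+1 = x.
Proof.
case: mE => m_le [e [e' eK e'K] H] [j _ <-] [k _ tk].
have E1 : m (e' (inl j)) = s j by rewrite H e'K.
have E2 : m (e' (inr k)) = s j by rewrite H e'K.
have ne : e' (inl j) <> e' (inr k) by move=> /(congr1 e); rewrite !e'K.
have squeeze i i' : (i < i')%N -> m i = s j -> m i' = s j ->
    exists2 i, m i = s j & m i.+1 = s j.
  move=> ii' e1 e2; exists i => //; apply/eqP; rewrite eq_le.
  by rewrite -{1}e2 m_le//= -e1 m_le.
have [h|h|//] := ltngtP (e' (inl j)) (e' (inr k)).
- exact: squeeze h E1 E2.
- exact: squeeze h E2 E1.
Qed.

(** Of three indices, two would come from the same one of [s] and [t]. *)
Lemma merged_at_most_twice (n : nat) : m n = m n.+1 -> m n.+1 < m n.+2.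
Proof.
move=> E; have [m_le [e [e' eK _] H]] := mE.
rewrite lt_neqAle m_le// andbT; apply/eqP => E'.
have ne i j : i <> j -> e i <> e j by move=> ij h; apply: ij; rewrite -(eK i) h eK.
have n1 : e n <> e n.+1 by apply: ne => /n_Sn.
have n2 : e n.+1 <> e n.+2 by apply: ne => /n_Sn.
have n3 : e n <> e n.+2 by apply: ne => h; have := leqnSn n.+1; rewrite -h ltnn.
rewrite !H in E E'; move: n1 n2 n3 E E'.
by case: (e n) (e n.+1) (e n.+2) => [i|i] [j|j] [k|k] /= n1 n2 n3 E E';
  rewrite ?E in E'; (try by case: n1; rewrite (inj s_inc E));
  (try by case: n1; rewrite (inj t_inc E));
  (try by case: n2; rewrite (inj s_inc E'));
  (try by case: n2; rewrite (inj t_inc E'));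
  case: n3; rewrite ?(inj s_inc (etrans E E')) ?(inj t_inc (etrans E E')).
Qed.

(** [T] meets [s] and [t] exactly at their common values and has one more
    element in each gap; the sequence built from these elements enumerates an
    initial segment of [T]. *)
Lemma interlacing_enumeration (T : set R) (lam : nat -> R) :
  increasing_enumeration T lam ->
  (forall x, range s x -> range t x -> T x) ->
  (forall x, T x -> range s x <-> range t x) ->
  (forall x y, range s x \/ range t x -> range s y \/ range t y -> x < y ->
    (forall z, x < z -> z < y -> ~ (range s z \/ range t z)) ->
    exists z, [/\ x < z, z < y & T z]) ->
  (forall x, range s x \/ range t x ->
    (forall z, z < x -> ~ (range s z \/ range t z)) -> exists2 z, z < x & T z) ->
  (forall x y, T x -> T y -> x < y ->
    exists2 z, x <= z <= y & range s z \/ range t z) ->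
  lam 0%N < m 0%N /\ forall n,
    (m n < m n.+1 -> m n < lam n.+1 /\ lam n.+1 < m n.+1) /\
    (m n = m n.+1 -> lam n.+1 = m n).
Proof.
move=> lamE common single gap first uniq.
have [m_le _] := mE; have lam_T k : T (lam k) by case: lamE => _ <-; exists k.
pose N x := range s x \/ range t x.
have mN n : N (m n) by apply/merged_range; exists n.
have NP x : N x -> exists n, m n = x by move=> /merged_range.
have gapN n z : m n < z -> z < m n.+1 -> ~ N z.
  move=> h1 h2 /NP[i iz]; move: h1 h2; rewrite -iz.
  by case: (leqP i n) => [/m_le|/m_le] h; [rewrite ltNge h|rewrite [_ < m n.+1]ltNge h].
have lowN z : z < m 0%N -> ~ N z.
  by move=> h /NP[i iz]; move: h; rewrite -iz ltNge m_le.
have [t0 t0m Tt0] := first _ (mN 0%N) lowN.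
(* In an empty gap, [m n = m n.+1], the element is the common value itself. *)
have /choice[L' HL'] : forall n, exists z, T z /\
    ((m n < m n.+1 /\ m n < z /\ z < m n.+1) \/ (m n = m n.+1 /\ z = m n)).
  move=> n; have := m_le _ _ (leqnSn n); rewrite le_eqVlt => /predU1P[E|lt].
    have [s1 t1] : range s (m n) /\ range t (m n).
      by apply: merged_repeated E => /n_Sn.
    by exists (m n); split; [exact: common|right].
  have [z [z1 z2 Tz]] := gap _ _ (mN n) (mN n.+1) lt (@gapN n).
  by exists z; split=> //; left.
pose L n := if n is k.+1 then L' k else t0.
have LE n : L n.+1 = L' n by [].
have LT n : T (L n) by case: n => [//|n]; have [] := HL' n.
have LS n : m n <= L n.+1 <= m n.+1.
  rewrite LE; have [_ [[_ [/ltW-> /ltW->//]]|[E ->]]] := HL' n.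
  by rewrite -E lexx.
have Lm n : L n <= m n.
  by case: n => [|n]; [exact: ltW|case/andP: (LS n)].
have L_inc : {homo L : i j / (i < j)%N >-> i < j}.
  apply: homo_ltn => [y x z|[|n]]; first exact: lt_trans.
    by apply: lt_le_trans t0m _; case/andP: (LS 0%N).
  rewrite LE; have [_ [[_ [_ h]]|[E ->]]] := HL' n.
    by apply: lt_le_trans h _; case/andP: (LS n.+1).
  have lt := merged_at_most_twice E.
  have [_ [[_ [h _]]|[E' _]]] := HL' n.+1; first by rewrite E.
  by rewrite E' ltxx in lt.
have no x y : T x -> T y -> (forall z, x <= z <= y -> ~ N z) -> ~ x < y.
  by move=> Tx Ty nz xy; have [z /nz + Nz] := uniq x y Tx Ty xy; exact.
have seg x n : T x -> x <= L n -> exists k, L k = x.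
  move=> Tx xL; have [Nx|Nx] := pselect (N x).
    have [sx tx] : range s x /\ range t x.
      by have [h1 h2] := single x Tx; case: Nx => h; split=> //; [exact: h1|exact: h2].
    have [i e1 e2] := merged_common sx tx; exists i.+1; rewrite LE.
    have [_ [[lt _]|[_ ->]//]] := HL' i.
    by move: lt; rewrite e1 e2 ltxx.
  have ne k : x <> m k by move=> E; apply: Nx; rewrite E.
  have ex : exists k, x < m k.
    by exists n; rewrite lt_neqAle (le_trans xL (Lm n)) andbT; apply/eqP/ne.
  case: (ex_minnP ex) => -[|k] xk mink.
    exists 0%N; have [h|h|//] := ltgtP (L 0%N) x.
      by case: (no _ _ (LT 0%N) Tx _ h) => z /andP[_ zx]; apply: lowN; exact: le_lt_trans xk.
    by case: (no _ _ Tx (LT 0%N) _ h) => z /andP[_ zx]; apply: lowN; exact: le_lt_trans t0m.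
  have kx : m k < x.
    rewrite lt_neqAle; apply/andP; split; first by apply/eqP => E; exact: (ne k).
    by rewrite leNgt; apply/negP => /mink; rewrite ltnn.
  exists k.+1; have [_ [[_ [l1 l2]]|[E _]]] := HL' k; last first.
    by have := lt_trans kx xk; rewrite E ltxx.
  have [h|h|//] := ltgtP (L k.+1) x.
    case: (no _ _ (LT k.+1) Tx _ h) => z /andP[z1 z2].
    by apply: (@gapN k); [exact: lt_le_trans z1|exact: le_lt_trans xk].
  case: (no _ _ Tx (LT k.+1) _ h) => z /andP[z1 z2].
  by apply: (@gapN k); [exact: lt_le_trans z1|exact: le_lt_trans l2].
have lamL := enumeration_initial_segment lamE L_inc LT seg.
split; first by rewrite lamL.
move=> n; rewrite lamL LE; have [_ [[lt [h1 h2]]|[E h]]] := HL' n.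
  by split=> // E; rewrite E ltxx in lt.
by split=> // lt; rewrite E ltxx in lt.
Qed.

End MergedEnumeration.

(* 0-based indices: lam n, lam' n, mu n are the terms of index n+1, so for
   n : nat the pair mu n, mu n.+1 is the pair of indices n+1, n+2. *)
Theorem corollary3p3 (R : realType) (M : R)
    (rho1 sigma1 q1 rho2 sigma2 q2 : R -> R)
    (lam lam' eta eta' mu : nat -> R)
    (M_gt0 : 0 < M)
    (rho1_H2 : in_H2 (-1) 0 rho1) (sigma1_H2 : in_H2 (-1) 0 sigma1)
    (q1_cont : {within `[-1, 0], continuous q1})
    (rho2_H2 : in_H2 0 1 rho2) (sigma2_H2 : in_H2 0 1 sigma2)
    (q2_cont : {within `[0, 1], continuous q2})
    (rho1_pos : uniformly_positive (-1) 0 rho1)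
    (sigma1_pos : uniformly_positive (-1) 0 sigma1)
    (q1_pos : uniformly_positive (-1) 0 q1)
    (rho2_pos : uniformly_positive 0 1 rho2)
    (sigma2_pos : uniformly_positive 0 1 sigma2)
    (q2_pos : uniformly_positive 0 1 q2)
    (lamE : increasing_enumeration
       [set l | transmission_eigenvalue M sigma1 q1 rho1 sigma2 q2 rho2 l] lam)
    (lam'E : increasing_enumeration
       [set l | transmission_eigenvalue 0 sigma1 q1 rho1 sigma2 q2 rho2 l] lam')
    (etaE : increasing_enumeration
       [set l | dirichlet_eigenvalue (-1) 0 sigma1 q1 rho1 l] eta)
    (eta'E : increasing_enumeration
       [set l | dirichlet_eigenvalue 0 1 sigma2 q2 rho2 l] eta')
    (muE : merged_enumeration eta eta' mu)
    (n : nat) :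
  (mu n <> mu n.+1 ->
     (lam 0%N < lam' 0%N /\ lam' 0%N < mu 0%N) /\
     [/\ mu n < lam n.+1, lam n.+1 < lam' n.+1 & lam' n.+1 < mu n.+1]) /\
  (mu n = mu n.+1 -> mu n = lam n.+1 /\ lam n.+1 = lam' n.+1).
Proof.
have lt10 : (-1 : R) < 0 by rewrite ltrN10.
have [U1 [P1 [chi1 bp1]]] := sl_characteristic_pair_exists lt10
  sigma1_H2.1 q1_cont rho1_H2.1 sigma1_pos q1_pos rho1_pos.
have [U2 [P2 [chi2 bp2]]] := sl_characteristic_pair_right_exists ltr01
  sigma2_H2.1 q2_cont rho2_H2.1 sigma2_pos q2_pos rho2_pos.
have etaP x : range eta x <-> U1 x = 0.
  by rewrite etaE.2; exact: dirichlet_eigenvalue_left bp1.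
have eta'P x : range eta' x <-> U2 x = 0.
  by rewrite eta'E.2; exact: dirichlet_eigenvalue_right bp2.
have NP x : range eta x \/ range eta' x <-> U1 x = 0 \/ U2 x = 0.
  by rewrite etaP eta'P.
have TP M' x : transmission_eigenvalue M' sigma1 q1 rho1 sigma2 q2 rho2 x <->
    transmission_fun U1 P1 U2 P2 M' x = 0.
  exact: transmission_eigenvalueP chi1.1 bp1 bp2.
have main M' nu : 0 <= M' -> increasing_enumeration
    [set l | transmission_eigenvalue M' sigma1 q1 rho1 sigma2 q2 rho2 l] nu ->
    nu 0%N < mu 0%N /\ forall n,
    (mu n < mu n.+1 -> mu n < nu n.+1 /\ nu n.+1 < mu n.+1) /\
    (mu n = mu n.+1 -> nu n.+1 = mu n).
  move=> M'0 nuE.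
  apply: (interlacing_enumeration etaE.1 eta'E.1 muE nuE) => [x|x|x y|x|x y].
  - rewrite etaP eta'P /= TP /transmission_fun => -> ->.
    by rewrite !(mul0r, mulr0) subr0 addr0.
  - move=> /TP/(transmission_root_single chi1 chi2); rewrite etaP eta'P; exact.
  - rewrite !NP => Zx Zy xy nz.
    have [|t [h1 h2 /TP h3]] := transmission_gap_root chi1 chi2 M'0 Zx Zy xy.
      by move=> z h1 h2; rewrite -NP; exact: nz.
    by exists t.
  - rewrite NP => Zx nz.
    have [|t h1 /TP h2] := transmission_first_root chi1 chi2 M'0 Zx.
      by move=> z h; rewrite -NP; exact: nz.
    by exists t.
  - move=> /TP Tx /TP Ty xy.
    have [z zxy Zz] := transmission_root_unique chi1 chi2 M'0 Tx Ty xy.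
    by exists z => //; rewrite NP.
have [lam0 lamS] := main M lam (ltW M_gt0) lamE.
have [lam'0 lam'S] := main 0 lam' (lexx 0) lam'E.
have [mu_le _] := muE.
have muP x : U1 x = 0 \/ U2 x = 0 -> exists k, mu k = x.
  by rewrite -NP => /(merged_range muE).
have lam_root k : transmission_fun U1 P1 U2 P2 M (lam k) = 0.
  by apply/TP; case: lamE => _ /seteqP[+ _]; apply; exists k.
have lam'_root k : transmission_fun U1 P1 U2 P2 0 (lam' k) = 0.
  by apply/TP; case: lam'E => _ /seteqP[+ _]; apply; exists k.
split=> [mun|mun]; last first.
  by rewrite (lamS n).2// (lam'S n).2.
have lt : mu n < mu n.+1 by rewrite lt_neqAle mu_le// andbT; apply/eqP.
have [l1 l2] := (lamS n).1 lt; have [l'1 l'2] := (lam'S n).1 lt.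
split; split=> //.
- apply: (transmission_root_mass chi1 chi2 M_gt0 (lam_root _) (lam'_root _)) => x.
  move=> /andP[_ h].
  have {}h : x < mu 0%N by apply: le_lt_trans h _; rewrite gt_max lam0 lam'0.
  suff nz : ~ (U1 x = 0 \/ U2 x = 0) by split; apply/eqP => Z; apply: nz; [left|right].
  by move=> /muP[k kx]; move: h; rewrite -kx ltNge mu_le.
- apply: (transmission_root_mass chi1 chi2 M_gt0 (lam_root _) (lam'_root _)) => x.
  move=> /andP[h1 h2].
  have {}h1 : mu n < x by apply: lt_le_trans h1; rewrite lt_min l1 l'1.
  have {}h2 : x < mu n.+1 by apply: le_lt_trans h2 _; rewrite gt_max l2 l'2.
  suff nz : ~ (U1 x = 0 \/ U2 x = 0) by split; apply/eqP => Z; apply: nz; [left|right].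
  move=> /muP[k kx]; move: h1 h2; rewrite -kx.
  by case: (leqP k n) => [/mu_le|/mu_le] h; [rewrite ltNge h|move=> _; rewrite ltNge h].
Qed.
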